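(* Let $A$ be (the unitary of) an $n$-qubit circuit $(G_0,\dots,G_{m-1})$. For a Pauli string $\mathbf P^0$ let $F_{\mathbf P^m}$, with weight function $W$, be the Boolean encoding of $\mathbf P^m := A\mathbf P^0A^\dagger$ defined in the context. Then $A\equiv I$ if and only if for every $P_j\in\{X_j,Z_j\mid j\in[n]\}$, taking $\mathbf P^0=P_j$, one has $$MC_W(F_{\mathbf P^m}\wedge F_{P_j})=1.$$
   Context: Equivalence. For $n$-qubit circuits (unitaries) $U,V$, $U\equiv V$ means there is a complex number $c$ such that $U|\psi\rangle=cV|\psi\rangle$ for all states $|\psi\rangle\in\mathbb C^{2^n}$; $I$ in $A\equiv I$ is the $2^n\times2^n$ identity. Pauli strings. $[n]=\{1,\dots,n\}$, $n\ge 1$. Write $\sigma[0,0]=I=\begin{pmatrix}1&0\\0&1\end{pmatrix}$, $\sigma[0,1]=Z=\begin{pmatrix}1&0\\0&-1\end{pmatrix}$, $\sigma[1,0]=X=\begin{pmatrix}0&1\\1&0\end{pmatrix}$, $\sigma[1,1]=Y=\begin{pmatrix}0&-i\\i&0\end{pmatrix}$. Pauli strings are the matrices $P_1\otimes\cdots\otimes P_n$ with $P_j\in\{I,X,Y,Z\}$. For a single-qubit operator $U$, $U_j=I^{\otimes j-1}\otimes U\otimes I^{\otimes n-j}$. Gates. A circuit is a list of gates $G_0,\dots,G_{m-1}$ ($m\ge1$), each one of $H_j,S_j,CZ_{jk},T_j,\mathrm{Toffoli}_{jkl},R_X(\theta)_j$ with $j,k,l\in[n]$ distinct and $\theta$ real,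 where $H=\frac1{\sqrt2}\begin{pmatrix}1&1\\1&-1\end{pmatrix}$, $S=\mathrm{diag}(1,i)$, $T=\mathrm{diag}(1,e^{i\pi/4})$, $R_X(\theta)=\begin{pmatrix}\cos(\theta/2)&-i\sin(\theta/2)\\-i\sin(\theta/2)&\cos(\theta/2)\end{pmatrix}$, $CZ=\mathrm{diag}(1,1,1,-1)$ (acting on qubits $j,k$), and $\mathrm{Toffoli}$ flips qubit $l$ iff qubits $j,k$ are both $1$ in the computational basis. With $U_G$ the $n$-qubit unitary of gate $G$, the unitary of the circuit is $A=U_{G_{m-1}}\cdots U_{G_0}$. Weighted model counting. For a Boolean formula $F$ over a finite set $V$ of variables and a weight function $W$ assigning a real number to each literal $x,\overline x$ ($x\in V$), $MC_W(F)=\sum_{\alpha\in\{0,1\}^V}F(\alpha)\,W(\alpha)$, where $W(\alpha)$ is the product over $x\in V$ of $W(x)$ if $\alpha(x)=1$ and $W(\overline x)$ if $\alpha(x)=0$. Encoding. The variables are $x_j^t,z_j^t$ ($j\in[n]$) and $r^t$ for $t=0,\dots,m$, plus the auxiliary variables $u$ introduced below for certain gates. $F_{\mathbf P^m}:=F_{\mathbf P^0}\wedge\bigwedge_{i=0}^{m-1}F_{G_i}$. The initial formula $F_{\mathbf P^0}$ for $\mathbf P^0=\bigotimes_j\sigma[a_j,b_j]$ is the conjunction of literals forcing $x_j^0=a_j$, $z_j^0=b_j$ for all $j$, and $r^0=0$. The final formula $F_P$ (used with $P=P_j$) for $P=\bigotimes_j\sigma[a_j,b_j]$ is the conjunction of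 literals forcing $x_j^m=a_j$, $z_j^m=b_j$ for all $j$ (with $r^m$ unconstrained). For a gate $G_t$ the constraint $F_{G_t}$ is the conjunction of the formulas listed below ($\oplus$ is exclusive or, juxtaposition is conjunction), together with $a^{t+1}\Leftrightarrow a^t$ for each $a\in\{x_j,z_j\mid j\in[n]\}\cup\{r\}$ whose time-$(t+1)$ copy does not occur in the listed formulas: - $H_j$: $r^{t+1}\Leftrightarrow r^t\oplus x_j^tz_j^t$; $z_j^{t+1}\Leftrightarrow x_j^t$; $x_j^{t+1}\Leftrightarrow z_j^t$. - $S_j$: $r^{t+1}\Leftrightarrow r^t\oplus x_j^tz_j^t$; $z_j^{t+1}\Leftrightarrow x_j^t\oplus z_j^t$. - $CZ_{jk}$: $r^{t+1}\Leftrightarrow r^t\oplus x_j^tx_k^t(z_k^t\oplus z_j^t)$; $z_k^{t+1}\Leftrightarrow z_k^t\oplus x_j^t$; $z_j^{t+1}\Leftrightarrow z_j^t\oplus x_k^t$. - $T_j$: $x_j^{t+1}\Leftrightarrow x_j^t$; $x_j^t\vee(z_j^{t+1}\Leftrightarrow z_j^t)$; $r^{t+1}\Leftrightarrow r^t\oplus x_j^tz_j^t\overline{z_j^{t+1}}$; $u^t\Leftrightarrow x_j^t$, with a new variable $u^t$. - $R_X(\theta)_j$: $z_j^t\vee(x_j^{t+1}\Leftrightarrow x_j^t)$; $z_j^{t+1}\Leftrightarrow z_j^t$; $r^{t+1}\Leftrightarrow r^t\oplus \overline{x_j^t}z_j^tx_j^{t+1}$; $u_c^t\Leftrightarrow z_j^t(x_j^{t+1}\Leftrightarrow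 x_j^t)$; $u_s^t\Leftrightarrow z_j^t(x_j^{t+1}\oplus x_j^t)$, with new variables $u_c^t,u_s^t$. - $\mathrm{Toffoli}_{jkl}$: let $P^t,P^{t+1}$ denote the three-qubit Pauli strings $\bigotimes_{q\in(j,k,l)}\sigma[x_q^t,z_q^t]$ and $\bigotimes_{q\in(j,k,l)}\sigma[x_q^{t+1},z_q^{t+1}]$, and let $c(P,Q)=\frac18\operatorname{Tr}(Q\cdot\mathrm{Toffoli}\,P\,\mathrm{Toffoli}^\dagger)\in\{0,\pm\frac12,\pm1\}$. The constraint states that $c(P^t,P^{t+1})\neq0$, that $r^{t+1}\Leftrightarrow r^t\oplus[c(P^t,P^{t+1})<0]$, and that $u^t\Leftrightarrow[\,|c(P^t,P^{t+1})|=\frac12\,]$, with a new variable $u^t$. Weights. $W(r^m)=-1$ and $W(\overline{r^m})=1$; for a $T$ gate at time $t$: $W(u^t)=\frac1{\sqrt2}$, $W(\overline{u^t})=1$; for a Toffoli gate: $W(u^t)=\frac12$, $W(\overline{u^t})=1$; for $R_X(\theta)$: $W(u_c^t)=\cos\theta$, $W(u_s^t)=\sin\theta$, $W(\overline{u_c^t})=W(\overline{u_s^t})=1$. All other literals have weight $1$. *)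

(* Defs.v *)
From HB Require Import structures.
From mathcomp Require Import all_boot all_order all_algebra.
From mathcomp Require Import mxtens complex.
From mathcomp Require Import reals trigo.

Set Implicit Arguments.
Unset Strict Implicit.
Unset Printing Implicit Defensive.

Import Order.TTheory GRing.Theory Num.Theory.
Local Open Scope ring_scope.
Local Open Scope complex_scope.

(* Qubits are numbered from 0: qubit j of 'I_n is the (j+1)-st tensor factor. *)

Definition mx2 (K : Type) (a b c d : K) : 'M[K]_2 :=
  \matrix_(i, j) (if i == 0 then (if j == 0 then a else b)
                  else (if j == 0 then c else d)).

(* f 0 (x) f 1 (x) ... (x) f (n-1), the first factor being most significant *)
Fixpoint tens (K : pzRingType) (n : nat) : ('I_n -> 'M[K]_2) -> 'M[K]_(2 ^ n) :=
  match n with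
  | 0 => fun _ => 1%:M
  | n'.+1 => fun f =>
      castmx (esym (expnS 2 n'), esym (expnS 2 n'))
        (f ord0 *t tens (fun q => f (lift ord0 q)))
  end.

Definition dagger (C : numClosedFieldType) (p q : nat) (A : 'M[C]_(p, q)) :
  'M[C]_(q, p) := map_mx Num.conj A^T.

Definition on_qubit (K : pzRingType) (n : nat) (j : 'I_n) (U : 'M[K]_2) :
  'M[K]_(2 ^ n) := tens (fun q => if q == j then U else 1%:M).

(* |a><b| for computational basis states a and b *)
Definition ketbra (K : pzRingType) (n : nat) (a b : {ffun 'I_n -> bool}) :
  'M[K]_(2 ^ n) :=
  tens (fun q => delta_mx (if a q then 1 else 0) (if b q then 1 else 0)).

Definition is_state (R : realType) (N : nat) (psi : 'cV[R[i]]_N) : Prop :=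
  dagger psi *m psi = 1%:M.

Definition equiv_mx (R : realType) (N : nat) (U V : 'M[R[i]]_N) : Prop :=
  exists c : R[i], forall psi : 'cV[R[i]]_N,
    is_state psi -> U *m psi = c *: (V *m psi).

Definition sigma (R : realType) (a b : bool) : 'M[R[i]]_2 :=
  match a, b with
  | false, false => 1%:M
  | false, true => mx2 1 0 0 (-1)
  | true, false => mx2 0 1 1 0
  | true, true => mx2 0 (- 'i) 'i 0
  end.

(* The pair (a, b) at qubit j stands for the factor sigma a b. *)
Definition pauli (n : nat) := {ffun 'I_n -> bool * bool}.

Definition pauli_mx (R : realType) (n : nat) (P : pauli n) : 'M[R[i]]_(2 ^ n) :=
  tens (fun q => sigma R (P q).1 (P q).2).

Definition pauliX (n : nat) (j : 'I_n) : pauli n := [ffun q => (q == j, false)].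
Definition pauliZ (n : nat) (j : 'I_n) : pauli n := [ffun q => (false, q == j)].

Lemma eq_tens (K : pzRingType) (n : nat) (f g : 'I_n -> 'M[K]_2) :
  f =1 g -> tens f = tens g.
Proof.
elim: n f g => [//|n IH] f g fg /=.
by rewrite fg (IH _ (fun q => g (lift ord0 q))).
Qed.

Lemma pauliXE (R : realType) (n : nat) (j : 'I_n) :
  pauli_mx R (pauliX j) = on_qubit j (sigma R true false).
Proof. by apply: eq_tens => q; rewrite ffunE /=; case: eqP. Qed.

Lemma pauliZE (R : realType) (n : nat) (j : 'I_n) :
  pauli_mx R (pauliZ j) = on_qubit j (sigma R false true).
Proof. by apply: eq_tens => q; rewrite ffunE /=; case: eqP. Qed.

Inductive gate (R : realType) (n : nat) : Type :=
  | GH (j : 'I_n)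
  | GS (j : 'I_n)
  | GCZ (j k : 'I_n) of j != k
  | GT (j : 'I_n)
  | GToffoli (j k l : 'I_n) of uniq [:: j; k; l]
  | GRX (theta : R) (j : 'I_n).

Section GateMatrices.
Variable R : realType.

Definition Hmx : 'M[R[i]]_2 := ((Num.sqrt 2)^-1)%:C *: mx2 1 1 1 (-1).

Definition Smx : 'M[R[i]]_2 := mx2 1 0 0 'i.

Definition Tmx : 'M[R[i]]_2 := mx2 1 0 0 (cos (pi / 4) +i* sin (pi / 4)).

Definition RXmx (theta : R) : 'M[R[i]]_2 :=
  let c := (cos (theta / 2))%:C in
  let s := - 'i * (sin (theta / 2))%:C in
  mx2 c s s c.

Definition CZmx (n : nat) (j k : 'I_n) : 'M[R[i]]_(2 ^ n) :=
  \sum_(b : {ffun 'I_n -> bool}) (-1) ^+ (b j && b k) *: ketbra R[i] b b.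

Definition Toffoli_mx (n : nat) (j k l : 'I_n) : 'M[R[i]]_(2 ^ n) :=
  \sum_(b : {ffun 'I_n -> bool})
    ketbra R[i] [ffun q => b q (+) [&& q == l, b j & b k]] b.

Definition gate_mx (n : nat) (g : gate R n) : 'M[R[i]]_(2 ^ n) :=
  match g with
  | GH j => on_qubit j Hmx
  | GS j => on_qubit j Smx
  | GCZ j k _ => CZmx j k
  | GT j => on_qubit j Tmx
  | GToffoli j k l _ => Toffoli_mx j k l
  | GRX theta j => on_qubit j (RXmx theta)
  end.

Definition circuit_mx (n : nat) (G : seq (gate R n)) : 'M[R[i]]_(2 ^ n) :=
  foldl (fun A g => gate_mx g *m A) 1%:M G.

End GateMatrices.

(* A formula is identified with the Boolean function it denotes. *)
Definition formula (V : finType) := {ffun V -> bool} -> bool.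

Definition fand (V : finType) (F1 F2 : formula V) : formula V :=
  fun alpha => F1 alpha && F2 alpha.

(* W v true and W v false are the weights of the literals v and ~v. *)
Definition MC (R : realType) (V : finType) (W : V -> bool -> R) (F : formula V) : R :=
  \sum_(alpha : {ffun V -> bool}) (F alpha)%:R * \prod_(v : V) W v (alpha v).

(* For GRX, true is u_c and false is u_s. *)
Definition aux (R : realType) (n : nat) (g : gate R n) : finType :=
  match g with
  | GT _ => unit
  | GToffoli _ _ _ _ => unit
  | GRX _ _ => bool
  | _ => void
  end.

Section Variables.
Variables (R : realType) (n m : nat) (G : m.-tuple (gate R n)).

Inductive var : Type :=
  | Xvar (t : 'I_m.+1) (j : 'I_n)
  | Zvar (t : 'I_m.+1) (j : 'I_n)
  | Rvar (t : 'I_m.+1)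
  | Uvar (t : 'I_m) (a : aux (tnth G t)).

Let code : Type :=
  ('I_m.+1 * 'I_n + 'I_m.+1 * 'I_n + 'I_m.+1 + {t : 'I_m & aux (tnth G t)})%type.

Definition var_code (v : var) : code :=
  match v with
  | Xvar t j => inl (inl (inl (t, j)))
  | Zvar t j => inl (inl (inr (t, j)))
  | Rvar t => inl (inr t)
  | Uvar t a => inr (existT _ t a)
  end.

Definition var_decode (c : code) : var :=
  match c with
  | inl (inl (inl (t, j))) => Xvar t j
  | inl (inl (inr (t, j))) => Zvar t j
  | inl (inr t) => Rvar t
  | inr (existT t a) => Uvar a
  end.

Lemma var_codeK : cancel var_code var_decode.
Proof. by case. Qed.

HB.instance Definition _ := Finite.copy var (can_type var_codeK).

End Variables.

(* The coefficient of Q in the Pauli expansion of Toffoli P Toffoli^dagger. It is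
   a real number, so the order of R[i] is the expected one on it. *)
Definition toffoli_coef (R : realType) (P Q : pauli 3) : R[i] :=
  let Tof := Toffoli_mx R (inord 0 : 'I_3) (inord 1) (inord 2) in
  8^-1 * \tr (pauli_mx R Q *m (Tof *m pauli_mx R P *m dagger Tof)).

Definition pauli_at (n : nat) (x z : 'I_n -> bool) (j k l : 'I_n) : pauli 3 :=
  [ffun q => let q' := tnth [tuple j; k; l] q in (x q', z q')].

Definition unchanged (n : nat) (v v' : 'I_n -> bool) (A : seq 'I_n) : bool :=
  [forall q, (q \notin A) ==> (v' q == v q)].

(* x, z, r are the values at time t and x', z', r' those at time t+1; u gives
   the values of the auxiliary variables of the gate. *)
Definition gate_constraint (R : realType) (n : nat) (g : gate R n)
    (x z : 'I_n -> bool) (r : bool) (x' z' : 'I_n -> bool) (r' : bool) :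
    (aux g -> bool) -> bool :=
  match g return (aux g -> bool) -> bool with
  | GH j => fun _ =>
      [&& r' == r (+) (x j && z j), z' j == x j, x' j == z j,
          unchanged x x' [:: j] & unchanged z z' [:: j]]
  | GS j => fun _ =>
      [&& r' == r (+) (x j && z j), z' j == x j (+) z j,
          unchanged x x' [::] & unchanged z z' [:: j]]
  | GCZ j k _ => fun _ =>
      [&& r' == r (+) [&& x j, x k & z k (+) z j],
          z' k == z k (+) x j, z' j == z j (+) x k,
          unchanged x x' [::] & unchanged z z' [:: j; k]]
  | GT j => fun u =>
      [&& x' j == x j, x j || (z' j == z j),
          r' == r (+) [&& x j, z j & ~~ z' j], u tt == x j,
          unchanged x x' [:: j] & unchanged z z' [:: j]]
  | GToffoli j k l _ => fun u =>
      let c := toffoli_coef R (pauli_at x z j k l) (pauli_at x' z' j k l) in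
      [&& c != 0, r' == r (+) (c < 0), u tt == (`|c| == 2^-1),
          unchanged x x' [:: j; k; l] & unchanged z z' [:: j; k; l]]
  | GRX _ j => fun u =>
      [&& z j || (x' j == x j), z' j == z j,
          r' == r (+) [&& ~~ x j, z j & x' j],
          u true == (z j && (x' j == x j)), u false == (z j && (x' j (+) x j)),
          unchanged x x' [:: j] & unchanged z z' [:: j]]
  end.

Definition aux_weight (R : realType) (n : nat) (g : gate R n) :
    aux g -> bool -> R :=
  match g return aux g -> bool -> R with
  | GT _ => fun _ b => if b then (Num.sqrt 2)^-1 else 1
  | GToffoli _ _ _ _ => fun _ b => if b then 2^-1 else 1
  | GRX theta _ => fun a b =>
      if b then (if a then cos theta else sin theta) else 1
  | _ => fun _ _ => 1
  end.

Section Encoding.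
Variables (R : realType) (n m : nat) (G : m.-tuple (gate R n)).

Definition init_formula (P : pauli n) : formula (var G) := fun alpha =>
  [forall j, (alpha (Xvar G ord0 j) == (P j).1) &&
             (alpha (Zvar G ord0 j) == (P j).2)]
  && ~~ alpha (Rvar G ord0).

Definition final_formula (P : pauli n) : formula (var G) := fun alpha =>
  [forall j, (alpha (Xvar G ord_max j) == (P j).1) &&
             (alpha (Zvar G ord_max j) == (P j).2)].

Definition gate_formula (t : 'I_m) : formula (var G) := fun alpha =>
  let t0 : 'I_m.+1 := widen_ord (leqnSn m) t in
  let t1 : 'I_m.+1 := lift ord0 t in
  gate_constraint
    (fun j => alpha (Xvar G t0 j)) (fun j => alpha (Zvar G t0 j)) (alpha (Rvar G t0))
    (fun j => alpha (Xvar G t1 j)) (fun j => alpha (Zvar G t1 j)) (alpha (Rvar G t1))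
    (fun a : aux (tnth G t) => alpha (Uvar a)).

Definition encoding (P : pauli n) : formula (var G) :=
  fand (init_formula P) (fun alpha => [forall t, gate_formula t alpha]).

Definition weight (v : var G) (b : bool) : R :=
  match v with
  | Rvar t => if (t == ord_max) && b then -1 else 1
  | Uvar t a => aux_weight a b
  | _ => 1
  end.

End Encoding.

Arguments init_formula {R n m} G P.
Arguments final_formula {R n m} G P.
Arguments encoding {R n m} G P.
Arguments weight {R n m} G v b.

(* Main.v *)
Require Import Defs.
From mathcomp Require Import all_boot all_order all_algebra.
From mathcomp Require Import mxtens complex.
From mathcomp Require Import reals trigo.
From mathcomp Require Import ring.
Set Implicit Arguments.
Unset Strict Implicit.
Unset Printing Implicit Defensive.
Import Order.TTheory GRing.Theory Num.Theory.
Local Open Scope ring_scope.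
Local Open Scope complex_scope.

(* Conjugation by a gate maps a Pauli string P to a real combination of Pauli
   strings Q, and the coefficient of Q is the signed weight that the constraint
   of the gate gives to the transition from P to Q. Coefficients compose like
   matrix products, so the model count, a sum over paths of Pauli strings, is the
   coefficient 2^-n tr(Q A P A^dagger) of Q in A P A^dagger.
   If A is scalar these coefficients are 1 for Q = P. Conversely, when the
   coefficient of P is 1, B = A P A^dagger and P are Hermitian involutions with
   tr(P B) = 2^n, so |B - P|^2 = 0 and A commutes with P. If A commutes with all
   X_j and Z_j, every Pauli string other than the identity, as it anticommutes
   with one of them, has coefficient 0 in A, so A is scalar. *)

(** * Computational basis states and the entries of tensor products *)

Definition bit (b : bool) : 'I_2 := if b then 1 else 0.

Lemma bit_inj : injective bit. Proof. by do 2!case. Qed.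

Lemma big_bit (K : nmodType) (F : 'I_2 -> K) : \sum_i F i = \sum_b F (bit b).
Proof.
by rewrite big_bool big_ord_recl big_ord1 addrC; congr (F _ + F _); apply: val_inj.
Qed.

(** Row index of a basis state. It follows the recursion of [tens], so the bit of qubit [ord0] is
    the most significant one. *)
Fixpoint qidx (n : nat) : {ffun 'I_n -> bool} -> 'I_(2 ^ n) :=
  match n with
  | 0 => fun _ => Ordinal (ltnSn 0)
  | n'.+1 => fun a => cast_ord (esym (expnS 2 n'))
      (mxtens_index (bit (a ord0), qidx [ffun q => a (lift ord0 q)]))
  end.

Lemma qidx_inj n : injective (@qidx n).
Proof.
elim: n => [|n IH] a b; first by move=> _; apply/ffunP => -[].
move/cast_ord_inj/(can_inj (@mxtens_indexK _ _)) => -[/bit_inj ab0 /IH /ffunP ab].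
by apply/ffunP => q; case: (unliftP ord0 q) => [q' ->|->//]; have := ab q'; rewrite !ffunE.
Qed.

Lemma qidx_bij n : bijective (@qidx n).
Proof. by apply: inj_card_bij (@qidx_inj n) _; rewrite card_ord card_ffun card_bool card_ord. Qed.

Lemma big_qidx (K : nmodType) n (F : 'I_(2 ^ n) -> K) :
  \sum_i F i = \sum_a F (qidx a).
Proof. by rewrite (reindex _ (onW_bij _ (@qidx_bij n))). Qed.

Lemma mx_qidxP (K : Type) n (A B : 'M[K]_(2 ^ n)) :
  (forall a b, A (qidx a) (qidx b) = B (qidx a) (qidx b)) -> A = B.
Proof.
have [h _ hK] := @qidx_bij n.
by move=> AB; apply/matrixP => i j; rewrite -(hK i) -(hK j).
Qed.

Section TensEntries.
Variables (K : pzRingType) (n : nat).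
Implicit Types (f g : 'I_n -> 'M[K]_2) (a b : {ffun 'I_n -> bool}).

Lemma tensE f a b :
  tens f (qidx a) (qidx b) = \prod_q f q (bit (a q)) (bit (b q)).
Proof.
elim: n f a b => [|m IH] f a b /=; first by rewrite big_ord0 mxE.
rewrite castmxE !cast_ordK tensmxE IH big_ord_recl.
by congr (_ * _); apply: eq_bigr => q _; rewrite !ffunE.
Qed.

End TensEntries.

Section Tens.
Variables (K : comPzRingType) (n : nat).
Implicit Types (f g : 'I_n -> 'M[K]_2) (a b : {ffun 'I_n -> bool}).

Lemma mx1_qidxE a b : 1%:M (qidx a) (qidx b) = (a == b)%:R :> K.
Proof. by rewrite mxE (inj_eq (@qidx_inj n)). Qed.

Lemma prodr_bool (I : finType) (B : I -> bool) : \prod_i (B i)%:R = [forall i, B i]%:R :> K.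
Proof.
case: (altP forallP) => [B1|/forallPn[i /negbTE Bi]]; first by apply: big1 => i _; rewrite B1.
by rewrite (bigD1 i) //= Bi mul0r.
Qed.

Lemma eq_ffunE a b : (a == b) = [forall q, a q == b q].
Proof. by apply/eqP/forallP => [-> //|ab]; apply/ffunP => q; apply/eqP. Qed.

Lemma tens1 : tens (fun _ => 1%:M) = 1%:M :> 'M[K]_(2 ^ n).
Proof.
apply: mx_qidxP => a b; rewrite tensE mx1_qidxE eq_ffunE -prodr_bool.
by apply: eq_bigr => q _; rewrite mxE (inj_eq bit_inj).
Qed.

Lemma ketbraE (c d a b : {ffun 'I_n -> bool}) :
  ketbra K c d (qidx a) (qidx b) = ((a == c) && (b == d))%:R.
Proof.
rewrite tensE !eq_ffunE.
transitivity (\prod_q ((a q == c q) && (b q == d q))%:R : K).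
  by apply: eq_bigr => q _; rewrite mxE -!/(bit _) !(inj_eq bit_inj).
rewrite prodr_bool; congr (_%:R); congr nat_of_bool.
apply/forallP/andP => [H|[/forallP H1 /forallP H2] q]; last by rewrite H1 H2.
by split; apply/forallP => q; have /andP[] := H q.
Qed.

(** The mixed-product rule: a sum over intermediate basis states of a product over qubits
    distributes into a product of two-term sums. *)
Lemma tens_mul f g : tens f *m tens g = tens (fun q => f q *m g q).
Proof.
apply: mx_qidxP => a b; rewrite mxE big_qidx tensE; apply/esym.
transitivity (\prod_q \sum_(c : bool) f q (bit (a q)) (bit c) * g q (bit c) (bit (b q))).
  by apply: eq_bigr => q _; rewrite mxE big_bit.
rewrite bigA_distr_bigA; apply: eq_bigr => c _.
by rewrite (tensE f a) (tensE g c) -big_split.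
Qed.

Lemma tens_tr f : \tr (tens f) = \prod_q \tr (f q).
Proof.
apply/esym; transitivity (\prod_q \sum_(c : bool) f q (bit c) (bit c)).
  by apply: eq_bigr => q _; rewrite /mxtrace big_bit.
rewrite bigA_distr_bigA /mxtrace big_qidx; apply: eq_bigr => c _.
by rewrite (tensE f c).
Qed.

Lemma tens_scale (c : 'I_n -> K) f :
  tens (fun q => c q *: f q) = (\prod_q c q) *: tens f.
Proof.
apply: mx_qidxP => a b; rewrite mxE !tensE -big_split.
by apply: eq_bigr => q _; rewrite mxE.
Qed.

End Tens.

Lemma tens_dagger (C : numClosedFieldType) n (f : 'I_n -> 'M[C]_2) :
  dagger (tens f) = tens (fun q => dagger (f q)).
Proof.
apply: mx_qidxP => a b; rewrite !mxE !tensE rmorph_prod.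
by apply: eq_bigr => q _; rewrite !mxE.
Qed.

(** * Conjugate transpose and the Frobenius norm *)

Section Dagger.
Variable C : numClosedFieldType.

Lemma daggerM m n p (A : 'M[C]_(m, n)) (B : 'M[C]_(n, p)) :
  dagger (A *m B) = dagger B *m dagger A.
Proof. by rewrite /dagger trmx_mul map_mxM. Qed.

Lemma daggerB m n (A B : 'M[C]_(m, n)) : dagger (A - B) = dagger A - dagger B.
Proof. by rewrite /dagger linearB /= map_mxB. Qed.

Lemma daggerZ m n c (A : 'M[C]_(m, n)) : dagger (c *: A) = Num.conj c *: dagger A.
Proof. by rewrite /dagger linearZ /= map_mxZ. Qed.

Lemma dagger1 n : dagger 1%:M = 1%:M :> 'M[C]_n.
Proof. by rewrite /dagger trmx1 map_mx1. Qed.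

Lemma daggerK m n (A : 'M[C]_(m, n)) : dagger (dagger A) = A.
Proof. by apply/matrixP => i j; rewrite !mxE conjCK. Qed.

(** This trace is the sum of the squared moduli of all entries. *)
Lemma mxtrace_dagger_eq0 m n (A : 'M[C]_(m, n)) : \tr (dagger A *m A) = 0 -> A = 0.
Proof.
move=> /eqP; rewrite /mxtrace.
under eq_bigr do (rewrite mxE; under eq_bigr do rewrite !mxE mulrC -normCK).
rewrite psumr_eq0 => [|i _]; last by apply: sumr_ge0 => j _; rewrite exprn_ge0.
move=> /allP A0; apply/matrixP => i j; rewrite mxE; apply/eqP.
have := A0 j (mem_index_enum _); rewrite psumr_eq0 => [|k _]; last by rewrite exprn_ge0.
by move/allP/(_ i (mem_index_enum _)); rewrite expf_eq0 normr_eq0.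
Qed.

End Dagger.

(** * Pauli matrices, Pauli expansions and transition coefficients *)

Section Pauli.
Variable R : realType.
Local Notation C := R[i].
(* The ['i] in sigma and RXmx may elaborate to the imaginary unit of the
   numClosedFieldType R[i], which is only convertible to [Complex 0 1]. *)
Local Notation ii := (Complex 0 1 : C).

Lemma conjcE (x : C) : Num.conj x = conjc x. Proof. by []. Qed.

Lemma iiN1 : ii * ii = -1.
Proof. by rewrite -expr2 sqr_i. Qed.

Lemma conj_i : Num.conj ii = - ii.
Proof. by rewrite conjcE; apply/eqP; rewrite eq_complex /= oppr0 !eqxx. Qed.

Lemma conjN (x : C) : Num.conj (- x) = - Num.conj x. Proof. exact: rmorphN. Qed.
Lemma conj0 : Num.conj (0 : C) = 0. Proof. exact: rmorph0. Qed.
Lemma conj1 : Num.conj (1 : C) = 1. Proof. exact: rmorph1. Qed.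

Lemma conj_real (x : R) : Num.conj x%:C = x%:C.
Proof. by rewrite conjcE; apply/eqP; rewrite eq_complex /= oppr0 !eqxx. Qed.

Lemma mx2_mul (a b c d a' b' c' d' : C) : mx2 a b c d *m mx2 a' b' c' d' =
  mx2 (a * a' + b * c') (a * b' + b * d') (c * a' + d * c') (c * b' + d * d').
Proof.
by apply/matrixP => i j; rewrite !mxE big_bit big_bool !mxE /= addrC; case: eqP; case: eqP.
Qed.

Lemma mx2_sub (a b c d a' b' c' d' : C) : mx2 a b c d - mx2 a' b' c' d' =
  mx2 (a - a') (b - b') (c - c') (d - d').
Proof. by apply/matrixP => i j; rewrite !mxE; case: eqP; case: eqP. Qed.

Lemma mx2_scale (x a b c d : C) : x *: mx2 a b c d = mx2 (x * a) (x * b) (x * c) (x * d).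
Proof. by apply/matrixP => i j; rewrite !mxE; case: eqP; case: eqP. Qed.

Lemma mx2_dagger (a b c d : C) : dagger (mx2 a b c d) =
  mx2 (Num.conj a) (Num.conj c) (Num.conj b) (Num.conj d).
Proof. by apply/matrixP => i j; rewrite !mxE; case: eqP; case: eqP. Qed.

Lemma mx2_tr (a b c d : C) : \tr (mx2 a b c d) = a + d.
Proof. by rewrite /mxtrace big_bit big_bool !mxE /= addrC. Qed.

Lemma mx2_1 : 1%:M = mx2 1 0 0 1 :> 'M[C]_2.
Proof.
by apply/matrixP => -[[|[|//]] ?] [[|[|//]] ?]; rewrite !mxE.
Qed.

Lemma sigmaE a b : sigma R a b =
  if a then (if b then mx2 0 (- ii) ii 0 else mx2 0 1 1 0)
  else (if b then mx2 1 0 0 (-1) else mx2 1 0 0 1).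
Proof. by case: a; case: b => //=; rewrite mx2_1. Qed.

Definition mx2E := (mx2_mul, mx2_sub, mx2_scale, mx2_dagger, mx2_tr, mx2_1, sigmaE,
  conj0, conj1, conj_i, conjN, conj_real).

Lemma sigma_dagger a b : dagger (sigma R a b) = sigma R a b.
Proof. by case: a; case: b; rewrite !mx2E //= ?opprK. Qed.

Lemma sigma_sqr a b : sigma R a b *m sigma R a b = 1%:M.
Proof. have := iiN1; case: a; case: b => i2; rewrite !mx2E //=; (congr mx2); ring: i2. Qed.

Lemma sigma_orth (s t : bool * bool) :
  \tr (sigma R s.1 s.2 *m sigma R t.1 t.2) = (2 * (s == t)%:R).
Proof.
by have := iiN1; case: s t => [[] []] [[] []] i2; rewrite !mx2E /=; ring: i2.
Qed.

(** Completeness relation: the sum of [sigma] tensor [sigma] over the four Pauli matrices is twice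
    the swap. *)
Lemma sigma_complete (a b c d : bool) :
  \sum_(s : bool * bool) sigma R s.1 s.2 (bit a) (bit b) * sigma R s.1 s.2 (bit c) (bit d)
  = 2 * ((a == d) && (b == c))%:R.
Proof.
have i2 := iiN1; rewrite -(pair_bigA _
  (fun x y => sigma R x y (bit a) (bit b) * sigma R x y (bit c) (bit d))).
rewrite !big_bool !mx2E /= !mxE.
case: a; case: b; case: c; case: d => /=; ring: i2.
Qed.

Section Coef.
Variable n : nat.
Implicit Types (P Q : pauli n) (U M : 'M[C]_(2 ^ n)) (f g : 'I_n -> 'M[C]_2).

Lemma pauli_dagger P : dagger (pauli_mx R P) = pauli_mx R P.
Proof. by rewrite tens_dagger; apply: eq_tens => q; rewrite sigma_dagger. Qed.

Lemma pauli_sqr P : pauli_mx R P *m pauli_mx R P = 1%:M.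
Proof. by rewrite tens_mul -tens1; apply: eq_tens => q; rewrite sigma_sqr. Qed.

Lemma pow2_neq0 : (2 ^ n)%:R != 0 :> C.
Proof. by rewrite pnatr_eq0 expn_eq0. Qed.

Lemma prod2 : \prod_(q < n) 2 = (2 ^ n)%:R :> C.
Proof. by rewrite prodr_const card_ord natrX. Qed.

Lemma pauli_orth P Q : \tr (pauli_mx R P *m pauli_mx R Q) = (2 ^ n)%:R * (P == Q)%:R.
Proof.
rewrite tens_mul tens_tr.
under eq_bigr do rewrite sigma_orth.
rewrite big_split /= prod2 prodr_bool; congr (_ * (nat_of_bool _)%:R).
by apply/forallP/eqP => [PQ|->//]; apply/ffunP => q; apply/eqP.
Qed.

Definition pcoef M Q : C := (2 ^ n)%:R^-1 * \tr (pauli_mx R Q *m M).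

(** Taken over all qubits, [sigma_complete] shows that summing products of two entries of [Q] over
    all strings [Q] singles out one entry of [M], up to the factor 2^n. *)
Lemma pauli_expand M : M = \sum_Q pcoef M Q *: pauli_mx R Q.
Proof.
apply: (scalerI pow2_neq0); apply: mx_qidxP => a b; rewrite scaler_sumr summxE !mxE.
transitivity (\sum_Q \sum_c \sum_d pauli_mx R Q (qidx c) (qidx d) * M (qidx d) (qidx c) *
    pauli_mx R Q (qidx a) (qidx b)); last first.
  apply: eq_bigr => Q _; rewrite !mxE !mulrA divff ?pow2_neq0 // mul1r /mxtrace big_qidx mulr_suml.
  by apply: eq_bigr => c _; rewrite mxE big_qidx mulr_suml.
(* Only the term with [c = b] and [d = a] survives the sum over [Q]. *)
rewrite exchange_big /= (bigD1 b) //= exchange_big /= (bigD1 a) //=.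
have key c d : \sum_Q pauli_mx R Q (qidx c) (qidx d) * M (qidx d) (qidx c) *
    pauli_mx R Q (qidx a) (qidx b) = (2 ^ n)%:R * ((c == b) && (d == a))%:R * M (qidx d) (qidx c).
  transitivity (M (qidx d) (qidx c) * \prod_q \sum_(s : bool * bool)
     sigma R s.1 s.2 (bit (c q)) (bit (d q)) * sigma R s.1 s.2 (bit (a q)) (bit (b q))).
    rewrite bigA_distr_bigA mulr_sumr; apply: eq_bigr => Q _.
    by rewrite big_split mulrAC mulrC; congr (_ * _); rewrite -!tensE.
  under eq_bigr do rewrite sigma_complete.
  rewrite big_split /= prod2 prodr_bool mulrC; congr (_ * (nat_of_bool _)%:R * _).
  apply/forallP/andP => [H|[/eqP -> /eqP -> q]]; last by rewrite !eqxx.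
  by split; apply/eqP/ffunP => q; have /andP[/eqP ? /eqP ?] := H q.
rewrite key !eqxx /= mulr1 big1 => [|d /negPf db]; last by rewrite key db andbF mulr0 mul0r.
rewrite big1 ?addr0 // => c /negPf cb.
by rewrite exchange_big big1 //= => d _; rewrite key cb mulr0 mul0r.
Qed.

(** Entry of the Pauli transfer matrix of conjugation by [U]. *)
Definition coef U P Q : C := pcoef (U *m pauli_mx R P *m dagger U) Q.

Lemma pcoef_sum (I : finType) (c : I -> C) (F : I -> 'M[C]_(2 ^ n)) Q :
  pcoef (\sum_i c i *: F i) Q = \sum_i c i * pcoef (F i) Q.
Proof.
rewrite /pcoef mulmx_sumr raddf_sum mulr_sumr; apply: eq_bigr => i _ /=.
by rewrite -scalemxAr mxtraceZ mulrCA.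
Qed.

(** Transfer matrices multiply: expand the conjugate of [P] by [U] in Pauli strings and conjugate
    each of them by [V]. *)
Lemma coef_mul U V P Q : coef (V *m U) P Q = \sum_S coef U P S * coef V S Q.
Proof.
rewrite /coef -pcoef_sum; congr (pcoef _ Q).
have -> : V *m U *m pauli_mx R P *m dagger (V *m U) =
    V *m (U *m pauli_mx R P *m dagger U) *m dagger V.
  by rewrite daggerM !mulmxA.
rewrite [X in V *m X *m _]pauli_expand mulmx_sumr mulmx_suml; apply: eq_bigr => S _.
by rewrite -scalemxAr -scalemxAl.
Qed.

Lemma coef_id P Q : coef 1%:M P Q = (P == Q)%:R.
Proof.
by rewrite /coef /pcoef dagger1 mulmx1 mul1mx pauli_orth mulKf ?pow2_neq0 // eq_sym.
Qed.

(** The two sides [f] and [g] are independent, since expanding the conjugation by [1 - tens f]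
    produces terms with a nontrivial factor on one side only. *)
Definition loc (f g : 'M[C]_2) (s t : bool * bool) : C :=
  2^-1 * \tr (sigma R t.1 t.2 *m (f *m sigma R s.1 s.2 *m g)).

Lemma loc1 s t : loc 1%:M 1%:M s t = (s == t)%:R.
Proof. by rewrite /loc mulmx1 mul1mx sigma_orth mulKf ?pnatr_eq0 // eq_sym. Qed.

Lemma pcoef_tens f g P Q :
  pcoef (tens f *m pauli_mx R P *m tens g) Q = \prod_q loc (f q) (g q) (P q) (Q q).
Proof.
rewrite /pcoef !tens_mul tens_tr -prod2 -prodfV -big_split.
by apply: eq_bigr.
Qed.

Definition same (A : seq 'I_n) P Q := [forall q, (q \notin A) ==> (Q q == P q)].

(** Off [A] each factor is a Kronecker delta by [loc1], and together these deltas form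
    [same A P Q]. *)
Lemma prod_loc A f g P Q : uniq A ->
    (forall q, q \notin A -> f q = 1%:M /\ g q = 1%:M) ->
  \prod_q loc (f q) (g q) (P q) (Q q) =
    (same A P Q)%:R * \prod_(q <- A) loc (f q) (g q) (P q) (Q q).
Proof.
move=> uA fg1; rewrite (bigID (mem A)) /= mulrC big_uniq //; congr (_ * _).
rewrite big_mkcond -prodr_bool; apply: eq_bigr => q _.
by case: ifP => // /fg1[-> ->]; rewrite loc1 eq_sym.
Qed.

Lemma pcoefB M N Q : pcoef (M - N) Q = pcoef M Q - pcoef N Q.
Proof. by rewrite /pcoef mulmxBr raddfB mulrBr. Qed.

(** With [F = tens f] Hermitian, [(1 - F) P (1 - F)] expands into four terms, each of which factors
    over the qubits. *)
Lemma coef_ctrl A f P Q : uniq A ->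
    (forall q, q \notin A -> f q = 1%:M) -> (forall q, dagger (f q) = f q) ->
  coef (1%:M - tens f) P Q = (same A P Q)%:R *
    (\prod_(q <- A) loc 1%:M 1%:M (P q) (Q q) - \prod_(q <- A) loc (f q) 1%:M (P q) (Q q)
     - (\prod_(q <- A) loc 1%:M (f q) (P q) (Q q) - \prod_(q <- A) loc (f q) (f q) (P q) (Q q))).
Proof.
move=> uA f1 fd; rewrite /coef daggerB dagger1 tens_dagger (eq_tens fd).
have key g h : (forall q, q \notin A -> g q = 1%:M /\ h q = 1%:M) ->
  pcoef (tens g *m pauli_mx R P *m tens h) Q =
    (same A P Q)%:R * \prod_(q <- A) loc (g q) (h q) (P q) (Q q).
  by move=> gh; rewrite pcoef_tens (prod_loc _ _ uA gh).
have k11 := key (fun=> 1%:M) (fun=> 1%:M) (fun _ _ => conj erefl erefl).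
have k1f := key (fun=> 1%:M) f (fun q qA => conj erefl (f1 q qA)).
have kf1 := key f (fun=> 1%:M) (fun q qA => conj (f1 q qA) erefl).
have kff := key f f (fun q qA => conj (f1 q qA) (f1 q qA)).
rewrite !tens1 ?mul1mx ?mulmx1 in k11 k1f kf1.
rewrite mulmxBr mulmxBl mul1mx mulmx1 mulmxBl !pcoefB k11 k1f kf1 kff.
by rewrite -!mulrBr.
Qed.

(** Half of [tens f] is an orthogonal projection, so [1 - tens f] is a Hermitian involution. *)
Lemma ctrl_unitary f :  (forall q, dagger (f q) = f q) ->
  tens f *m tens f = 2 *: tens f ->
  (1%:M - tens f) *m dagger (1%:M - tens f) = 1%:M.
Proof.
move=> fd f2; rewrite daggerB dagger1 tens_dagger (eq_tens fd).
rewrite mulmxBr mulmxBl mul1mx mulmx1 mulmxBl mul1mx f2 scaler_nat mulr2n.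
by rewrite opprB addrA -[X in X - tens f]addrA addKr addrK.
Qed.
End Coef.
End Pauli.

(** * CZ and Toffoli as reflections *)

Section Controlled.
Variables (R : realType) (n : nat).
Local Notation C := R[i].
Implicit Types (j k l q : 'I_n).

(* CZ and Toffoli are reflections 1 - tens f: 1 - 2 |11><11| and
   1 - 2 |11><11| (x) |-><-|, the factor 2 being absorbed in the last qubit. *)
Definition cz_factor j k q : 'M[C]_2 :=
  if q == j then mx2 0 0 0 1 else if q == k then mx2 0 0 0 2 else 1%:M.

Definition toffoli_factor j k l q : 'M[C]_2 :=
  if (q == j) || (q == k) then mx2 0 0 0 1
  else if q == l then mx2 1 (-1) (-1) 1 else 1%:M.

Lemma mx2_bit (K : Type) (a b c d : K) (u v : bool) : mx2 a b c d (bit u) (bit v) =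
  if u then (if v then d else c) else (if v then b else a).
Proof. by rewrite mxE; case: u; case: v. Qed.

Lemma CZmxE j k : j != k -> CZmx R j k = 1%:M - tens (cz_factor j k).
Proof.
move=> jk; apply: mx_qidxP => a b; rewrite !mxE summxE tensE (inj_eq (@qidx_inj n)).
rewrite (bigD1 b) //= big1 => [|c /negPf cb]; last first.
  by rewrite mxE ketbraE [b == c]eq_sym cb andbF mulr0.
rewrite addr0 mxE ketbraE eqxx andbT.
(* The matrix differs from the identity by 2, on the diagonal entries where both bits are set. *)
transitivity ((a == b)%:R - (a == b)%:R * (if b j && b k then 2 else 0) : C).
  by case: (a == b); case: (b j && b k); rewrite /= ?expr1 ?expr0; ring.
congr (_ - _); rewrite eq_ffunE -prodr_bool.
transitivity (\prod_q ((a q == b q)%:R *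
    (if q == j then (b j)%:R else if q == k then 2 * (b k)%:R else 1)) : C); last first.
  apply: eq_bigr => q _; rewrite /cz_factor; case: (q =P j) => [->|_].
    by rewrite mx2_bit; case: (a j); case: (b j); rewrite !(mulr1, mulr0, mul0r).
  case: (q =P k) => [->|_]; last by rewrite mxE (inj_eq bit_inj) mulr1.
  by rewrite mx2_bit; case: (a k); case: (b k); rewrite !(mulr1, mulr0, mul0r, mul1r).
rewrite big_split /=; congr (_ * _).
have kj : k != j by rewrite eq_sym.
rewrite (bigD1 j) //= eqxx (bigD1 k) //= eqxx (negPf kj) big1.
  by case: (b j); case: (b k); rewrite /=; ring.
by move=> q /andP[/negPf -> /negPf ->].
Qed.

Lemma Toffoli_mxE j k l : uniq [:: j; k; l] ->
  Toffoli_mx R j k l = 1%:M - tens (toffoli_factor j k l).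
Proof.
rewrite /= !inE negb_or => /and3P[/andP[jk jl] kl _].
apply: mx_qidxP => a b; rewrite !mxE summxE tensE (inj_eq (@qidx_inj n)).
rewrite (bigD1 b) //= big1 => [|c /negPf cb]; last first.
  by rewrite ketbraE [b == c]eq_sym cb andbF.
rewrite addr0 ketbraE eqxx andbT.
(* Qubit [l] contributes a sign, the entry of [1 - X]; all other qubits force equal bits, and the
   two controls moreover force the bit 1. *)
have -> : \prod_q toffoli_factor j k l q (bit (a q)) (bit (b q)) =
    (-1) ^+ (a l != b l) * ([forall q, (q != l) ==> (a q == b q)] && (b j && b k))%:R.
  rewrite (bigD1 l) //= /toffoli_factor eqxx [l == j]eq_sym [l == k]eq_sym (negPf jl) (negPf kl) /=.
  rewrite mx2_bit; congr (_ * _); first by case: (a l); case: (b l).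
  transitivity (\prod_(q | q != l)
      ((a q == b q)%:R * (if (q == j) || (q == k) then (b q)%:R else 1)) : C).
    apply: eq_bigr => q /negPf ql; rewrite ql; case: ifP => _.
      by rewrite mx2_bit; case: (a q); case: (b q); rewrite !(mulr1, mulr0, mul0r).
    by rewrite mxE (inj_eq bit_inj) mulr1.
  rewrite big_split /= -mulnb natrM; congr (_ * _).
    by rewrite big_mkcond -prodr_bool; apply: eq_bigr => q _; case: eqP.
  have kj : k != j by rewrite eq_sym.
  rewrite (bigD1 j) //= eqxx (bigD1 k) ?kl //= eqxx orbT big1.
    by rewrite mulr1 -natrM mulnb.
  by move=> q /andP[/andP[_ /negPf ->] /negPf ->].
case: (altP forallP) => [ab|/forallPn[q]]; last first.
  rewrite negb_imply => /andP[/negPf ql abq]; rewrite mulr0 subr0.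
  have /negPf -> : a != b by apply: contraNneq abq => ->.
  by case: eqP => // aE; move: abq; rewrite aE ffunE ql /= addbF eqxx.
(* Once [a] and [b] agree off [l], equality of basis states is decided at [l], and a check on four
   bits remains. *)
have eqE (c : {ffun 'I_n -> bool}) : (forall q, q != l -> c q = b q) -> (a == c) = (a l == c l).
  move=> cb; apply/eqP/eqP => [->//|acl]; apply/ffunP => q.
  by case: (eqVneq q l) => [->//|ql]; rewrite cb //; move/implyP/(_ ql)/eqP: (ab q).
rewrite eqE => [|q /negPf ql]; last by rewrite ffunE ql addbF.
rewrite eqE // ffunE eqxx /=.
by case: (a l); case: (b l); case: (b j); case: (b k); rewrite /= ?expr0 ?expr1; ring.
Qed.

Lemma cz_factor_dagger j k q : dagger (cz_factor j k q) = cz_factor j k q.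
Proof.
rewrite /cz_factor; case: ifP => _; last case: ifP => _.
- by rewrite !mx2E.
- by rewrite !mx2E -[2]/(1 + 1) rmorphD rmorph1.
- exact: dagger1.
Qed.

Lemma toffoli_factor_dagger j k l q :
  dagger (toffoli_factor j k l q) = toffoli_factor j k l q.
Proof.
rewrite /toffoli_factor; case: ifP => _; last case: ifP => _.
- by rewrite !mx2E.
- by rewrite !mx2E.
- exact: dagger1.
Qed.

(** Puts the scalar of the relation [F^2 = 2 F] on the one qubit whose factor is not idempotent. *)
Lemma prod2_at k : \prod_q (if q == k then 2 else 1 : C) = 2.
Proof. by rewrite (bigD1 k) //= eqxx big1 ?mulr1 // => q /negPf ->. Qed.

Lemma CZ_unitary j k : j != k -> CZmx R j k *m dagger (CZmx R j k) = 1%:M.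
Proof.
move=> jk; rewrite CZmxE //; apply: ctrl_unitary => [q|]; first exact: cz_factor_dagger.
rewrite tens_mul -[in RHS](prod2_at k) -tens_scale; apply: eq_tens => q.
rewrite /cz_factor; case: eqP => [->|_].
  by rewrite (negPf jk) scale1r !mx2E !(mulr0, mul0r, addr0, add0r, mulr1).
by case: eqP => _; rewrite ?mx2E ?scale1r ?mulmx1 // !(mulr0, mul0r, addr0, add0r, mulr1).
Qed.

Lemma Toffoli_unitary j k l : uniq [:: j; k; l] ->
  Toffoli_mx R j k l *m dagger (Toffoli_mx R j k l) = 1%:M.
Proof.
move=> jkl; rewrite Toffoli_mxE //.
apply: ctrl_unitary => [q|]; first exact: toffoli_factor_dagger.
move: jkl => /=; rewrite !inE negb_or => /and3P[/andP[jk jl] kl _].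
rewrite tens_mul -[in RHS](prod2_at l) -tens_scale; apply: eq_tens => q.
rewrite /toffoli_factor; case: (eqVneq q l) => [->|_].
  rewrite [l == j]eq_sym (negPf jl) [l == k]eq_sym (negPf kl) /= !mx2E.
  by congr mx2; ring.
by case: ifP => _; rewrite ?scale1r ?mulmx1 // !mx2E !(mulr0, mul0r, addr0, add0r, mulr1).
Qed.

End Controlled.

(** * Exact evaluation in Gaussian integers *)

Section Gaussian.

(* All factors of CZ and Toffoli have Gaussian integer entries, so their 4^4 and
   4^6 Pauli coefficients are evaluated exactly in pairs of integers. *)
Definition gint : Type := int * int.
Definition gadd (x y : gint) : gint := (x.1 + y.1, x.2 + y.2).
Definition gopp (x : gint) : gint := (- x.1, - x.2).
Definition gmul (x y : gint) : gint := (x.1 * y.1 - x.2 * y.2, x.1 * y.2 + x.2 * y.1).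

Definition gmx : Type := gint * gint * (gint * gint).

Definition gmx_mul (A B : gmx) : gmx :=
  let: ((a, b), (c, d)) := A in let: ((a', b'), (c', d')) := B in
  ((gadd (gmul a a') (gmul b c'), gadd (gmul a b') (gmul b d')),
   (gadd (gmul c a') (gmul d c'), gadd (gmul c b') (gmul d d'))).

Definition gmx_tr (A : gmx) : gint := gadd A.1.1 A.2.2.

Definition gsigma (s : bool * bool) : gmx :=
  match s with
  | (false, false) => (((1, 0), (0, 0)), ((0, 0), (1, 0)))
  | (false, true) => (((1, 0), (0, 0)), ((0, 0), (- 1, 0)))
  | (true, false) => (((0, 0), (1, 0)), ((1, 0), (0, 0)))
  | (true, true) => (((0, 0), (0, - 1)), ((0, 1), (0, 0)))
  end.

(** [loc] without its factor 1/2, which keeps the value integral. *)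
Definition gloc (f g : gmx) (s t : bool * bool) : gint :=
  gmx_tr (gmx_mul (gsigma t) (gmx_mul (gmx_mul f (gsigma s)) g)).

Definition gprod (w : seq gint) : gint := foldr gmul (1, 0) w.

(** The four-term expansion of [coef_ctrl], again unnormalised. An item of [w] holds the factor, the
    source and the target Pauli matrix of one qubit. *)
Definition gctrl (w : seq (gmx * (bool * bool) * (bool * bool))) : gint :=
  let G (h h' : gmx -> gmx) := gprod [seq gloc (h x.1.1) (h' x.1.1) x.1.2 x.2 | x <- w] in
  let one := fun=> gsigma (false, false) in
  gadd (gadd (G one one) (gopp (G id one))) (gopp (gadd (G one id) (gopp (G id id)))).

Variables (R : realType).
Local Notation C := R[i].
Local Notation ii := (Complex 0 1 : C).

Definition gval (x : gint) : C := x.1%:~R + ii * x.2%:~R.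

Lemma gvalD x y : gval (gadd x y) = gval x + gval y.
Proof. by rewrite /gval /= !rmorphD /=; ring. Qed.

Lemma gvalN x : gval (gopp x) = - gval x.
Proof. by rewrite /gval /= !rmorphN /=; ring. Qed.

Lemma gvalM x y : gval (gmul x y) = gval x * gval y.
Proof. by have i2 := iiN1 R; rewrite /gval /= rmorphB rmorphD !rmorphM /=; ring: i2. Qed.

Lemma gval_prod (w : seq gint) : gval (gprod w) = \prod_(x <- w) gval x.
Proof.
elim: w => [|x w IH]; last by rewrite big_cons -IH -gvalM.
by rewrite big_nil /gval mulr0 addr0.
Qed.

Definition mx_gval (A : gmx) : 'M[C]_2 :=
  mx2 (gval A.1.1) (gval A.1.2) (gval A.2.1) (gval A.2.2).

Lemma mx_gvalM A B : mx_gval (gmx_mul A B) = mx_gval A *m mx_gval B.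
Proof.
move: A B => [[a b] [c d]] [[a' b'] [c' d']].
by rewrite /mx_gval mx2_mul /= !gvalD !gvalM.
Qed.

Lemma gval_tr A : gval (gmx_tr A) = \tr (mx_gval A).
Proof. by rewrite mx2_tr gvalD. Qed.

Lemma gval_int (z : int) : gval (z, 0) = z%:~R.
Proof. by rewrite /gval mulr0 addr0. Qed.

Lemma mx_gval_sigma s : mx_gval (gsigma s) = sigma R s.1 s.2.
Proof.
by case: s => [[] []]; rewrite sigmaE /mx_gval /gval /=; congr mx2; ring.
Qed.

Lemma prodr_const_seq (I : Type) (w : seq I) (x : C) : \prod_(i <- w) x = x ^+ size w.
Proof. by rewrite big_const_seq count_predT iter_mulr_1. Qed.

Lemma loc_gval f g s t : loc (mx_gval f) (mx_gval g) s t = 2^-1 * gval (gloc f g s t).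
Proof. by rewrite /loc gval_tr !mx_gvalM !mx_gval_sigma. Qed.

(** In each of the four terms every qubit of [A] brings one factor 1/2 from [loc], hence a common
    power of 1/2. *)
Lemma coef_ctrl_gval n (A : seq 'I_n) (f : 'I_n -> 'M[C]_2) (g : 'I_n -> gmx) (P Q : pauli n) :
    uniq A -> (forall q, q \notin A -> f q = 1%:M) ->
    (forall q, dagger (f q) = f q) -> (forall q, q \in A -> f q = mx_gval (g q)) ->
  coef (1%:M - tens f) P Q = (same A P Q)%:R *
    ((2 ^+ size A)^-1 * gval (gctrl [seq (g q, P q, Q q) | q <- A])).
Proof.
move=> uA f1 fd fg; rewrite (coef_ctrl P Q uA f1 fd); congr (_ * _).
rewrite /gctrl !gvalD !gvalN !gvalD !gvalN -!map_comp !gval_prod !big_map.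
have one : 1%:M = mx_gval (gsigma (false, false)) by rewrite mx_gval_sigma.
have key (h h' : gmx -> gmx) (k k' : 'I_n -> 'M[C]_2) :
    (forall q, q \in A -> k q = mx_gval (h (g q))) ->
    (forall q, q \in A -> k' q = mx_gval (h' (g q))) ->
  \prod_(q <- A) loc (k q) (k' q) (P q) (Q q) =
  (2 ^+ size A)^-1 * \prod_(q <- A) gval (gloc (h (g q)) (h' (g q)) (P q) (Q q)).
  move=> kh kh'; rewrite -exprVn -prodr_const_seq -big_split /=.
  by apply: eq_big_seq => q qA; rewrite kh // kh' // loc_gval.
pose g1 : gmx -> gmx := fun=> gsigma (false, false).
rewrite !mulrBr; congr (_ - _ - (_ - _)).
- exact: (key g1 g1).
- exact: (key id g1).
- exact: (key g1 id).
- exact: (key id id).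
Qed.

End Gaussian.

(** [gP1], [gP2] and [gX2] encode |1><1|, 2 |1><1| and [1 - X]. *)
Definition gP1 : gmx := (((0, 0), (0, 0)), ((0, 0), (1, 0))).
Definition gP2 : gmx := (((0, 0), (0, 0)), ((0, 0), (2, 0))).
Definition gX2 : gmx := (((1, 0), (- 1, 0)), ((- 1, 0), (1, 0))).

Definition gctrl_Toffoli (s t : bool * bool * (bool * bool) * (bool * bool)) : gint :=
  gctrl [:: (gP1, s.1.1, t.1.1); (gP1, s.1.2, t.1.2); (gX2, s.2, t.2)].

(** Exhaustive evaluation; 4 and -4 stand for the coefficients 1 and -1 after division by
    [2 ^+ 2]. *)
Lemma gctrl_CZ_table (s1 s2 t1 t2 : bool * bool) :
  gctrl [:: (gP1, s1, t1); (gP2, s2, t2)] =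
  if (t1 == (s1.1, s1.2 (+) s2.1)) && (t2 == (s2.1, s2.2 (+) s1.1))
  then (if [&& s1.1, s2.1 & s2.2 (+) s1.2] then - 4 else 4, 0) else (0, 0).
Proof.
by case: s1 s2 t1 t2 => [[] []] [[] []] [[] []] [[] []]; apply/eqP; vm_compute.
Qed.

(** The constraint of Toffoli is phrased through the coefficient itself, so only its range matters;
    division by 8 turns the list into 0, 1/2, -1/2, 1, -1. *)
Lemma gctrl_Toffoli_table s t :
  gctrl_Toffoli s t \in [:: (0, 0); (4, 0); (- 4, 0); (8, 0); (- 8, 0)].
Proof.
(* Listing the 64 triples of Pauli matrices turns the 4096 cases into one Boolean computation. *)
pose bb := [seq (x, y) | x <- [:: true; false], y <- [:: true; false]].
pose b3 := [seq (x, y) | x <- [seq (x, y) | x <- bb, y <- bb], y <- bb].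
have in_b3 u : u \in b3 by case: u => [[[[] []] [[] []]] [[] []]].
have: all (fun s => all (fun t =>
   gctrl_Toffoli s t \in [:: (0, 0); (4, 0); (- 4, 0); (8, 0); (- 8, 0)]) b3) b3.
  by vm_compute.
by move/allP/(_ s (in_b3 _))/allP/(_ t (in_b3 _)).
Qed.

(** * Transition coefficients of gates acting on few qubits *)

Section GateCoefs.
Variables (R : realType) (n : nat).
Local Notation C := R[i].
Implicit Types (P Q : pauli n) (g : gate R n).

Lemma dagger_on_qubit j (U : 'M[C]_2) : dagger (on_qubit j U) = on_qubit j (dagger U) :> 'M_(2 ^ n).
Proof. by rewrite tens_dagger; apply: eq_tens => q; case: ifP => // _; exact: dagger1. Qed.

Lemma coef_on_qubit j (U : 'M[C]_2) P Q :
  coef (on_qubit j U) P Q = (same [:: j] P Q)%:R * loc U (dagger U) (P j) (Q j).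
Proof.
rewrite /coef dagger_on_qubit pcoef_tens (prod_loc _ _ (A := [:: j])) //.
  by rewrite big_seq1 eqxx.
by move=> q; rewrite inE => /negPf ->.
Qed.

Lemma on_qubit_unitary j (U : 'M[C]_2) : U *m dagger U = 1%:M ->
  on_qubit j U *m dagger (on_qubit j U) = 1%:M :> 'M_(2 ^ n).
Proof.
move=> U1; rewrite dagger_on_qubit tens_mul -tens1; apply: eq_tens => q.
by case: ifP => // _; rewrite mulmx1.
Qed.

Lemma coef_CZ j k P Q : j != k -> coef (CZmx R j k) P Q =
  (same [:: j; k] P Q)%:R * ((2 ^+ 2)^-1 *
    gval R (gctrl [:: (gP1, P j, Q j); (gP2, P k, Q k)])).
Proof.
move=> jk; have kj : k == j = false by rewrite eq_sym (negPf jk).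
rewrite CZmxE // (@coef_ctrl_gval R n [:: j; k] _ (fun q => if q == j then gP1 else gP2)) /=.
- by rewrite eqxx kj.
- by rewrite inE jk.
- by move=> q; rewrite !inE /cz_factor => /norP[/negPf -> /negPf ->].
- exact: cz_factor_dagger.
- move=> q; rewrite !inE /cz_factor; case: eqP => _ /=; last move=> ->.
    by rewrite /mx_gval /gval /= => _; congr mx2; ring.
  by rewrite /mx_gval /gval /=; congr mx2; ring.
Qed.

Lemma coef_Toffoli j k l P Q : uniq [:: j; k; l] -> coef (Toffoli_mx R j k l) P Q =
  (same [:: j; k; l] P Q)%:R * ((2 ^+ 3)^-1 *
    gval R (gctrl_Toffoli (P j, P k, P l) (Q j, Q k, Q l))).
Proof.
move=> jkl; have := jkl; rewrite /= !inE negb_or => /and3P[/andP[/negPf jk /negPf jl] /negPf kl _].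
rewrite Toffoli_mxE // (@coef_ctrl_gval R n [:: j; k; l] _
  (fun q => if (q == j) || (q == k) then gP1 else gX2)) //=.
- by rewrite !eqxx orbT [l == j]eq_sym jl [l == k]eq_sym kl.
- by move=> q; rewrite !inE /toffoli_factor => /norP[/negPf -> /norP[/negPf -> /negPf ->]].
- exact: toffoli_factor_dagger.
- move=> q; rewrite !inE /toffoli_factor orbA; case: ((q == j) || (q == k)) => /=; last move=> ->.
    by rewrite /mx_gval /gval /= => _; congr mx2; ring.
  by rewrite /mx_gval /gval /=; congr mx2; ring.
Qed.

End GateCoefs.

(** * The Toffoli coefficient and its five values *)

Section ToffoliCoef.
Variables (R : realType) (n : nat).
Local Notation C := R[i].
Implicit Types (P Q : pauli n) (g : gate R n).

Definition toffoli_val j k l P Q : C := toffoli_coef R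
  (pauli_at (fun q => (P q).1) (fun q => (P q).2) j k l)
  (pauli_at (fun q => (Q q).1) (fun q => (Q q).2) j k l).

(** [toffoli_coef] is convertible to [coef] of the Toffoli gate on three qubits, so [coef_Toffoli]
    evaluates it. *)
Lemma toffoli_valE j k l P Q : toffoli_val j k l P Q =
  (2 ^+ 3)^-1 * gval R (gctrl_Toffoli (P j, P k, P l) (Q j, Q k, Q l)).
Proof.
have -> : toffoli_val j k l P Q = coef (Toffoli_mx R (inord 0 : 'I_3) (inord 1) (inord 2))
  (pauli_at (fun q => (P q).1) (fun q => (P q).2) j k l)
  (pauli_at (fun q => (Q q).1) (fun q => (Q q).2) j k l).
  by [].
rewrite coef_Toffoli; last by rewrite /= !inE -!val_eqE /= !inordK.
(* The three qubits exhaust ['I_3], so nothing outside them is compared. *)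
have -> : same [:: inord 0; inord 1; inord 2]
  (pauli_at (fun q => (P q).1) (fun q => (P q).2) j k l)
  (pauli_at (fun q => (Q q).1) (fun q => (Q q).2) j k l).
  apply/forallP => q; suff -> : q \in [:: inord 0; inord 1; inord 2] by [].
  by rewrite !inE -!val_eqE /= !inordK //; case: q => [[|[|[|]]]].
rewrite mul1r /pauli_at !ffunE !(tnth_nth j) /= !inordK //=.
by rewrite -!surjective_pairing.
Qed.

(** Support, sign and the test for modulus 1/2 determine each of these five numbers; they are the
    three facts that the Toffoli constraint records. *)
Lemma signed_value (x : R) (c := x%:C) : x \in [:: 0; 2^-1; - 2^-1; 1; -1] ->
  c = ((c != 0)%:R * (-1) ^+ (c < 0)%R * (if `|c| == 2^-1 then 2^-1 else 1))%:C.
Proof.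
have h0 : 0 < 2^-1 :> R by rewrite invr_gt0.
have h1 : (1 == 2^-1 :> R) = false by rewrite -(inj_eq invr_inj) invr1 invrK (eqr_nat _ 1 2).
move=> xP; rewrite /c; congr (_%:C).
have -> : (x%:C != 0 :> C) = (x != 0) by rewrite eq_complex /= eqxx andbT.
have -> : (x%:C < 0 :> C) = (x < 0) by rewrite -(ltcR x 0).
have -> : (`|x%:C| == 2^-1 :> C) = (`|x| == 2^-1).
  rewrite normc_def /= expr0n addr0 sqrtr_sqr -[RHS](inj_eq (@complexI R)).
  by rewrite fmorphV rmorph_nat.
move: xP; rewrite !inE => /orP[/eqP->|/orP[/eqP->|/orP[/eqP->|/orP[/eqP->|/eqP->]]]].
- by rewrite eqxx mul0r mul0r.
- by rewrite gt_eqF // ltNge ltW // ger0_norm ?ltW // eqxx /= !mul1r.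
- by rewrite oppr_eq0 gt_eqF // oppr_lt0 h0 normrN ger0_norm ?ltW // eqxx /= expr1 mul1r mulN1r.
- by rewrite oner_eq0 ltr10 normr1 h1 /= !mulr1.
- by rewrite oppr_eq0 oner_eq0 oppr_lt0 ltr01 normrN normr1 h1 /= expr1 mul1r mulr1.
Qed.

Lemma toffoli_val_signed j k l P Q (c := toffoli_val j k l P Q) :
  c = ((c != 0)%:R * (-1) ^+ (c < 0)%R * (if `|c| == 2^-1 then 2^-1 else 1))%:C.
Proof.
suff [x xP cE] : exists2 x : R, x \in [:: 0; 2^-1; - 2^-1; 1; -1] & c = x%:C.
  by rewrite cE; exact: signed_value.
have n8 : (2 ^+ 3 : R) != 0 by rewrite expf_neq0 // pnatr_eq0.
have val (z : int) : (2 ^+ 3)^-1 * gval R (z, 0) = (z%:~R / 2 ^+ 3)%:C.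
  by rewrite gval_int mulrC rmorphM fmorphV rmorphXn rmorph_nat rmorph_int.
rewrite /c toffoli_valE; have := gctrl_Toffoli_table (P j, P k, P l) (Q j, Q k, Q l).
rewrite !inE => /orP[/eqP->|/orP[/eqP->|/orP[/eqP->|/orP[/eqP->|/eqP->]]]]; rewrite val.
- by exists 0; rewrite ?inE ?eqxx ?mul0r.
- by exists 2^-1; rewrite ?inE ?eqxx ?orbT //; congr (_%:C); field.
- by exists (- 2^-1); rewrite ?inE ?eqxx ?orbT //; congr (_%:C); field.
- by exists 1; rewrite ?inE ?eqxx ?orbT //; congr (_%:C); field.
- by exists (-1); rewrite ?inE ?eqxx ?orbT //; congr (_%:C); field.
Qed.

End ToffoliCoef.

(** * A common form of the gate constraints *)

Section GateConstraints.
Variables (R : realType) (n : nat).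
Local Notation C := R[i].
Implicit Types (P Q : pauli n) (g : gate R n).

Definition gate_qubits g : seq 'I_n :=
  match g with
  | GH j | GS j | GT j | GRX _ j => [:: j]
  | GCZ j k _ => [:: j; k]
  | GToffoli j k l _ => [:: j; k; l]
  end.

Definition gate_local g P Q : bool :=
  match g with
  | GH j => Q j == ((P j).2, (P j).1)
  | GS j => Q j == ((P j).1, (P j).1 (+) (P j).2)
  | GCZ j k _ => (Q j == ((P j).1, (P j).2 (+) (P k).1)) &&
                 (Q k == ((P k).1, (P k).2 (+) (P j).1))
  | GT j => ((Q j).1 == (P j).1) && ((P j).1 || ((Q j).2 == (P j).2))
  | GToffoli j k l _ => toffoli_val R j k l P Q != 0
  | GRX _ j => ((Q j).2 == (P j).2) && ((P j).2 || ((Q j).1 == (P j).1))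
  end.

(** [gate_support], [gate_sign] and [gate_aux] separate a constraint into the allowed transitions,
    the sign flip and the forced auxiliary values. *)
Definition gate_support g P Q := gate_local g P Q && same (gate_qubits g) P Q.

Definition gate_sign g P Q : bool :=
  match g with
  | GH j | GS j => (P j).1 && (P j).2
  | GCZ j k _ => [&& (P j).1, (P k).1 & (P k).2 (+) (P j).2]
  | GT j => [&& (P j).1, (P j).2 & ~~ (Q j).2]
  | GToffoli j k l _ => (toffoli_val R j k l P Q < 0)%R
  | GRX _ j => [&& ~~ (P j).1, (P j).2 & (Q j).1]
  end.

(** For [GRX], the label [true] turns the exclusive or of the two [x] bits into their equality,
    which is the cosine case; [false] leaves it unchanged, for the sine. *)
Definition gate_aux g P Q : aux g -> bool :=
  match g return aux g -> bool with
  | GT j => fun=> (P j).1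
  | GToffoli j k l _ => fun=> `|toffoli_val R j k l P Q| == 2^-1
  | GRX _ j => fun a => (P j).2 && ((Q j).1 (+) (P j).1 (+) a)
  | _ => fun=> false
  end.

Definition pauli_of (x z : 'I_n -> bool) : pauli n := [ffun q => (x q, z q)].

Lemma pauli_of_fst x z q : (pauli_of x z q).1 = x q. Proof. by rewrite ffunE. Qed.
Lemma pauli_of_snd x z q : (pauli_of x z q).2 = z q. Proof. by rewrite ffunE. Qed.

Lemma toffoli_val_of j k l x z x' z' :
  toffoli_val R j k l (pauli_of x z) (pauli_of x' z') =
  toffoli_coef R (pauli_at x z j k l) (pauli_at x' z' j k l).
Proof.
have atE y w : pauli_at (fun q => (pauli_of y w q).1) (fun q => (pauli_of y w q).2) j k l =
    pauli_at y w j k l.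
  by apply/ffunP => q; rewrite [LHS]ffunE [RHS]ffunE /= !ffunE.
by rewrite /toffoli_val !atE.
Qed.

Lemma unchanged_same x z x' z' A :
  unchanged x x' A && unchanged z z' A = same A (pauli_of x z) (pauli_of x' z').
Proof.
apply/andP/forallP => [[/forallP hx /forallP hz] q|h].
  apply/implyP => qA; rewrite !ffunE; move: (hx q) (hz q).
  by rewrite qA => /eqP-> /eqP->.
split; apply/forallP => q; apply/implyP => qA;
  by have := h q; rewrite qA !ffunE => /eqP[/eqP ? /eqP ?].
Qed.

(** S and CZ preserve all [x] bits, while the common form speaks of the qubits outside
    [gate_qubits]; the bits inside are split off here. *)
Lemma unchanged0 (v v' : 'I_n -> bool) A :
  unchanged v v' [::] = all (fun q => v' q == v q) A && unchanged v v' A.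
Proof.
apply/forallP/andP => [h|[/allP hA /forallP h] q /=].
  by split; [apply/allP => q _; exact: h|apply/forallP => q; rewrite (implyP (h q)) ?implybT].
by have [/hA->//|/(implyP (h q))] := boolP (q \in A).
Qed.

(** The counting argument relies on this form: it exhibits [r'] and [u] as functions of [r] and the
    two Pauli strings. *)
Lemma gate_constraintE g x z r x' z' r' (u : aux g -> bool) :
  let P := pauli_of x z in let Q := pauli_of x' z' in
  gate_constraint x z r x' z' r' u =
  [&& gate_support g P Q, r' == r (+) gate_sign g P Q & [forall a, u a == gate_aux P Q a]].
Proof.
move=> P Q; rewrite /gate_support; case: g u => [j|j|j k jk|j|j k l jkl|theta j] u /=.
- rewrite -unchanged_same !ffunE /= xpair_eqE.
  have -> : [forall a, u a == false] by apply/forallP => -[].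
  by case: (r' == _); case: (x' j == _); case: (z' j == _); rewrite ?andbF //= ?andbT.
- rewrite -unchanged_same (unchanged0 _ _ [:: j]) !ffunE /= xpair_eqE.
  have -> : [forall a, u a == false] by apply/forallP => -[].
  by case: (r' == _); case: (x' j == _); case: (z' j == _); rewrite ?andbF //= ?andbT.
- rewrite -unchanged_same (unchanged0 _ _ [:: j; k]) !ffunE /= !xpair_eqE.
  have -> : [forall a, u a == false] by apply/forallP => -[].
  by case: (r' == _); case: (x' j == _); case: (z' j == _); case: (x' k == _);
    case: (z' k == _); rewrite ?andbF //= ?andbT.
- rewrite -unchanged_same !ffunE /=.
  have -> : [forall a, u a == x j] = (u tt == x j).
    by apply/forallP/idP => [|h []] //; exact.
  by case: (r' == _); case: (x' j == _); case: (x j || _); case: (u tt == _);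
    rewrite ?andbF //= ?andbT.
- rewrite toffoli_val_of -unchanged_same.
  set c := toffoli_coef _ _ _.
  have -> : [forall a, u a == (`|c| == 2^-1)] = (u tt == (`|c| == 2^-1)).
    by apply/forallP/idP => [|h []] //; exact.
  by case: (c != 0); case: (r' == _); case: (u tt == _); rewrite ?andbF //= ?andbT.
- rewrite -unchanged_same !ffunE /=.
  have -> : [forall a, u a == z j && (x' j (+) x j (+) a)] =
      (u true == (z j && (x' j == x j))) && (u false == (z j && (x' j (+) x j))).
    apply/forallP/andP => [h|[h1 h0] []]; last 2 first.
    + by rewrite addbT; move: h1; case: (x' j); case: (x j).
    + by rewrite addbF.
    by split; [move: (h true); case: (x' j); case: (x j)|move: (h false); rewrite addbF].
  by case: (r' == _); case: (z' j == _); case: (z j || _); case: (u true == _);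
    case: (u false == _); rewrite ?andbF //= ?andbT.
Qed.

Definition gate_weight g P Q : R :=
  (gate_support g P Q)%:R * (-1) ^+ gate_sign g P Q *
  \prod_a aux_weight a (gate_aux (g := g) P Q a).

Lemma prod_aux0 (F : void -> R) : \prod_a F a = 1.
Proof. by apply: big1 => -[]. Qed.

Lemma prod_aux1 (F : unit -> R) : \prod_a F a = F tt.
Proof. by rewrite (big_pred1 tt) // => -[]. Qed.

End GateConstraints.

(** * Transition coefficients of H, S, T and the X rotations *)

Definition gH : gmx := (((1, 0), (1, 0)), ((1, 0), (- 1, 0))).
Definition gS : gmx := (((1, 0), (0, 0)), ((0, 0), (0, 1))).
Definition gSd : gmx := (((1, 0), (0, 0)), ((0, 0), (0, - 1))).

(** [gH] is H scaled by the square root of 2. The two scalings and the factor 1/2 left out of [gloc]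
    turn the coefficients 1 and -1 into 4 and -4. *)
Lemma gloc_H_table (s t : bool * bool) :
  gloc gH gH s t = if t == (s.2, s.1) then (if s.1 && s.2 then - 4 else 4, 0) else (0, 0).
Proof. by case: s t => [[] []] [[] []]; apply/eqP; vm_compute. Qed.

Lemma gloc_S_table (s t : bool * bool) : gloc gS gSd s t =
  if t == (s.1, s.1 (+) s.2) then (if s.1 && s.2 then - 2 else 2, 0) else (0, 0).
Proof. by case: s t => [[] []] [[] []]; apply/eqP; vm_compute. Qed.

Section GateLoc.
Variables (R : realType).
Local Notation C := R[i].
Local Notation ii := (Complex 0 1 : C).

Lemma locZ (a b : C) f g s t : loc (a *: f) (b *: g) s t = a * b * loc f g s t.
Proof.
by rewrite /loc -!scalemxAl -!scalemxAr !mxtraceZ; ring.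
Qed.

Lemma sqrtV2_sqr : (Num.sqrt 2)^-1%:C * (Num.sqrt 2)^-1%:C = 2^-1 :> C.
Proof. by rewrite -rmorphM -invfM -expr2 sqr_sqrtr ?ler0n // fmorphV rmorph_nat. Qed.

Lemma HmxE : Hmx R = (Num.sqrt 2)^-1%:C *: mx_gval R gH.
Proof. by rewrite /Hmx /mx_gval /gval /=; congr (_ *: mx2 _ _ _ _); ring. Qed.

Lemma Hmx_dagger : dagger (Hmx R) = Hmx R.
Proof.
rewrite /Hmx daggerZ conj_real mx2_dagger.
by rewrite !conjN !conj1.
Qed.

Lemma loc_H s t : loc (Hmx R) (dagger (Hmx R)) s t =
  ((t == (s.2, s.1))%:R * (-1) ^+ (s.1 && s.2)).
Proof.
rewrite Hmx_dagger HmxE locZ sqrtV2_sqr loc_gval gloc_H_table.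
by case: (t == _); case: (s.1 && s.2); rewrite gval_int /= ?expr0 ?expr1; field.
Qed.

Lemma SmxE : Smx R = mx_gval R gS.
Proof. by rewrite /Smx /mx_gval /gval /=; congr mx2; rewrite ?mul1r; ring. Qed.

Lemma Smx_dagger : dagger (Smx R) = mx_gval R gSd.
Proof.
rewrite /Smx mx2_dagger conj0 conj1 conj_i /mx_gval /gval /=.
by congr mx2; ring.
Qed.

Lemma loc_S s t : loc (Smx R) (dagger (Smx R)) s t =
  ((t == (s.1, s.1 (+) s.2))%:R * (-1) ^+ (s.1 && s.2)).
Proof.
rewrite Smx_dagger SmxE loc_gval gloc_S_table.
by case: (t == _); case: (s.1 && s.2); rewrite gval_int /= ?expr0 ?expr1; field.
Qed.

(** From [0 = cos (pi / 2) = 2 cos^2 (pi / 4) - 1], taking the nonnegative root. *)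
Lemma cos_pi4 : cos (pi / 4) = (Num.sqrt 2)^-1 :> R.
Proof.
have dbl : (pi / 4) *+ 2 = pi / 2 :> R by rewrite mulr2n; field.
have c2 : cos (pi / 4) ^+ 2 = 2^-1 :> R.
  have /eqP := cos_mulr2n (pi / 4 : R); rewrite dbl cos_pihalf eq_sym subr_eq0 -mulr_natr => /eqP h.
  by rewrite -[LHS](mulfK (x := 2)) ?pnatr_eq0 // h mul1r.
rewrite -[RHS]sqrtrV ?ler0n // -c2 sqrtr_sqr ger0_norm //.
apply: cos_ge0_pihalf; apply/andP; split.
  by rewrite (@le_trans _ _ 0) ?oppr_le0 // divr_ge0 ?pi_ge0.
by rewrite ler_pM2l ?pi_gt0 // lef_pV2 ?posrE // ler_nat.
Qed.

Lemma sin_pi4 : sin (pi / 4) = (Num.sqrt 2)^-1 :> R.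
Proof.
by rewrite -cos_pi4 -cosBpihalf -cosN; congr cos; field.
Qed.

Lemma loc_T s t : loc (Tmx R) (dagger (Tmx R)) s t =
  ((t.1 == s.1) && (s.1 || (t.2 == s.2)))%:R * (-1) ^+ [&& s.1, s.2 & ~~ t.2] *
  (if s.1 then (Num.sqrt 2)^-1%:C else 1).
Proof.
have i2 := iiN1 R; have h2 := sqrtV2_sqr.
set h := _%:C in h2 *.
have -> : Tmx R = mx2 1 0 0 (h + ii * h).
  by rewrite /Tmx cos_pi4 sin_pi4 [_ +i* _]complexE.
rewrite mx2_dagger conj0 conj1 rmorphD rmorphM /= conj_i conj_real -/h /loc.
have h3 : 2 * (h * h) = 1 by rewrite h2 divff ?pnatr_eq0.
(* From here on [h] is a generic number with [2 h^2 = 1], and each case is an algebraic identity. *)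
clearbody h; case: s => [[] []]; case: t => [[] []];
  rewrite !sigmaE !mx2_mul mx2_tr /= ?(expr0, expr1); try by field: i2 h3.
(* The cases left are transitions between the identity and Z, whose coefficient vanishes because
   [1 - 2 h^2 = 0]. *)
all: apply: (@mulfI C 2); rewrite ?pnatr_eq0 // mulVKf ?pnatr_eq0 //.
all: transitivity (1 - 2 * (h * h)); [ring: i2|rewrite h3; ring].
Qed.

Lemma loc_RX theta s t : loc (RXmx theta) (dagger (RXmx theta)) s t =
  ((t.2 == s.2) && (s.2 || (t.1 == s.1)))%:R * (-1) ^+ [&& ~~ s.1, s.2 & t.1] *
  (if s.2 then (if t.1 == s.1 then cos theta else sin theta)%:C else 1 : C).
Proof.
have i2 := iiN1 R; set c : C := (cos (theta / 2))%:C; set r : C := (sin (theta / 2))%:C.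
have theta2 : theta = (theta / 2) *+ 2 by rewrite mulr2n; field.
have cr1 : c * c = 1 - r * r.
  have := congr1 (real_complex R) (cos2Dsin2 (theta / 2)).
  by rewrite rmorphD !rmorphXn rmorph1 /= -/c -/r => <-; ring.
have cE : (cos theta)%:C = 1 - r * r - r * r.
  rewrite {1}theta2 cos_mulr2n mulr2n !rmorphB rmorphD rmorph1 !expr2 !rmorphM /= -/c cr1.
  by ring.
have rE : (sin theta)%:C = c * r + c * r.
  by rewrite {1}theta2 sin_mulr2n mulr2n !rmorphD !rmorphM.
have -> : RXmx theta = mx2 c (- ii * r) (- ii * r) c by [].
rewrite mx2_dagger rmorphM /= conjN conj_i !conj_real opprK -/c -/r /loc.
(* [cE] and [rE] express the full angle through the half angle, about which only [c^2 = 1 - r^2] is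
   kept. *)
clearbody c r.
by case: s => [[] []]; case: t => [[] []];
  rewrite !sigmaE !mx2_mul mx2_tr /= ?(expr0, expr1) ?cE ?rE; field: i2 cr1.
Qed.

End GateLoc.

(** * Constraint weights as transition coefficients; unitarity of the gates *)

Section GateExpansion.
Variables (R : realType) (n : nat).
Local Notation C := R[i].
Implicit Types (P Q : pauli n) (g : gate R n).

(** Support, sign and auxiliary weights match the local coefficients factor by factor; in particular
    the transfer matrix of a gate is real. *)
Lemma coef_gate g P Q : coef (gate_mx g) P Q = (gate_weight g P Q)%:C.
Proof.
rewrite /gate_weight /gate_support -mulnb natrM !rmorphM /= !rmorph_nat rmorphXn rmorphN1.
rewrite [_%:R * (same _ _ _)%:R]mulrC -!mulrA.
case: g => [j|j|j k jk|j|j k l jkl|theta j] /=.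
- by rewrite coef_on_qubit loc_H (prod_aux0 (fun=> 1)) rmorph1 mulr1.
- by rewrite coef_on_qubit loc_S (prod_aux0 (fun=> 1)) rmorph1 mulr1.
- rewrite coef_CZ // gctrl_CZ_table (prod_aux0 (fun=> 1)) rmorph1 mulr1; congr (_ * _).
  by case: (_ && _); case: [&& _, _ & _]; rewrite gval_int /= ?expr0 ?expr1; field.
- rewrite coef_on_qubit loc_T (prod_aux1 (fun a => if (P j).1 then _ else _)) -!mulrA.
  by congr (_ * (_ * (_ * _))); case: ifP => //; rewrite rmorph1.
- rewrite coef_Toffoli // -toffoli_valE (prod_aux1 (fun a => if _ then _ else _)).
  rewrite [LHS]/= {1}toffoli_val_signed !rmorphM /= rmorph_nat rmorphXn rmorphN1 -!mulrA.
  by [].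
- rewrite coef_on_qubit loc_RX big_bool /= addbT addbF -!mulrA; congr (_ * (_ * (_ * _))).
  case: (P j).2 => /=; last by rewrite mulr1 rmorph1.
  by case: (P j).1; case: (Q j).1; rewrite /= ?mulr1 ?mul1r.
Qed.

Lemma gate_unitary g : gate_mx g *m dagger (gate_mx g) = 1%:M.
Proof.
have i2 := iiN1 R.
case: g => [j|j|j k jk|j|j k l jkl|theta j] /=; rewrite ?CZ_unitary ?Toffoli_unitary //;
  apply: on_qubit_unitary.
- rewrite Hmx_dagger /Hmx -scalemxAl -scalemxAr scalerA sqrtV2_sqr mx2_mul mx2_scale mx2_1.
  by congr mx2; field.
- by rewrite Smx_dagger SmxE /mx_gval mx2_mul mx2_1 /gval /=; congr mx2; ring: i2.
- rewrite /Tmx [_ +i* _]complexE mx2_dagger conj0 conj1 rmorphD rmorphM /= conj_i !conj_real.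
  rewrite mx2_mul mx2_1; congr mx2; try ring.
  have := congr1 (real_complex R) (cos2Dsin2 (pi / 4)).
  by rewrite rmorphD !rmorphXn rmorph1 /= => <-; ring: i2.
- have -> : RXmx theta = mx2 (cos (theta / 2))%:C (- (Complex 0 1) * (sin (theta / 2))%:C)
     (- (Complex 0 1) * (sin (theta / 2))%:C) (cos (theta / 2))%:C by [].
  rewrite mx2_dagger rmorphM /= conjN conj_i !conj_real opprK mx2_mul mx2_1.
  have := congr1 (real_complex R) (cos2Dsin2 (theta / 2)).
  rewrite rmorphD !rmorphXn rmorph1 /= => cs.
  by congr mx2; rewrite -?cs; ring: i2.
Qed.
End GateExpansion.

(** * Splitting off the first state of a path *)

Section FfunCons.
Variables (T : finType) (K : nmodType) (k : nat).

Definition ffun_cons (a : T) (s : {ffun 'I_k -> T}) : {ffun 'I_k.+1 -> T} :=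
  [ffun i => if unlift ord0 i is Some j then s j else a].

Lemma ffun_cons0 a s : ffun_cons a s ord0 = a.
Proof. by rewrite ffunE unlift_none. Qed.

Lemma ffun_consS a s j : ffun_cons a s (lift ord0 j) = s j.
Proof. by rewrite ffunE liftK. Qed.

Lemma big_ffun_cons (F : {ffun 'I_k.+1 -> T} -> K) :
  \sum_s F s = \sum_a \sum_s F (ffun_cons a s).
Proof.
rewrite pair_bigA (reindex (fun p => ffun_cons p.1 p.2)) //=.
exists (fun s => (s ord0, [ffun j => s (lift ord0 j)])) => [[a s] _|s _] /=.
  by rewrite ffun_cons0; congr pair; apply/ffunP => j; rewrite !ffunE liftK.
by apply/ffunP => i; case: (unliftP ord0 i) => [j|] ->; rewrite ?ffun_consS ?ffun_cons0 ?ffunE.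
Qed.

End FfunCons.

(** * Weighted sums over paths of signed Pauli strings *)

Section Counting.
Variables (R : realType) (n : nat).
Local Notation C := R[i].
Local Notation state := (pauli n * bool)%type.
Implicit Types (P Q S : pauli n) (g : gate R n) (a b : state).

(** The sign is carried by the second component of the state, not by the weight. It becomes a factor
    -1 only at the end of the path, as in the encoding, where only the last [r] is weighted. *)
Definition step g a b : R :=
  (gate_support g a.1 b.1 && (b.2 == a.2 (+) gate_sign g a.1 b.1))%:R *
  \prod_c aux_weight c (gate_aux (g := g) a.1 b.1 c).

Definition path_weight m (G : m.-tuple (gate R n)) (s : {ffun 'I_m.+1 -> state}) : R :=
  \prod_t step (tnth G t) (s (widen_ord (leqnSn m) t)) (s (lift ord0 t)).

Definition path_sum m (G : m.-tuple (gate R n)) a Q : R :=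
  \sum_(s : {ffun 'I_m.+1 -> state})
    (s ord0 == a)%:R * ((s ord_max).1 == Q)%:R * (-1) ^+ (s ord_max).2 * path_weight G s.

Lemma sum_pred1 (I : finType) (i : I) (F : I -> R) : \sum_j (j == i)%:R * F j = F i.
Proof.
rewrite (bigD1 i) //= eqxx mul1r big1 ?addr0 // => j /negPf ->; exact: mul0r.
Qed.

Lemma path_sum_nil (G : 0.-tuple (gate R n)) a Q :
  path_sum G a Q = (a.1 == Q)%:R * (-1) ^+ a.2.
Proof.
rewrite /path_sum big_ffun_cons.
transitivity (\sum_b (b == a)%:R * ((b.1 == Q)%:R * (-1) ^+ b.2 : R)); last exact: sum_pred1.
apply: eq_bigr => b _; rewrite (eq_bigr (fun=> (b == a)%:R * ((b.1 == Q)%:R * (-1) ^+ b.2))).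
  by rewrite sumr_const card_ffun card_ord expn0 mulr1n.
move=> s _; have -> : ord_max = ord0 :> 'I_1 by apply: val_inj.
by rewrite ffun_cons0 /path_weight big_ord0 mulr1 mulrA.
Qed.

(** First-step recursion: the tail of the path is a path for [G] that starts at the second state. *)
Lemma path_sum_cons m g (G : m.-tuple (gate R n)) a Q :
  path_sum [tuple of g :: G] a Q = \sum_b step g a b * path_sum G b Q.
Proof.
rewrite /path_sum big_ffun_cons.
transitivity (\sum_a' (a' == a)%:R * \sum_(s : {ffun 'I_m.+1 -> state})
   step g a' (s ord0) * (((s ord_max).1 == Q)%:R * (-1) ^+ (s ord_max).2 * path_weight G s)).
  apply: eq_bigr => a' _; rewrite mulr_sumr; apply: eq_bigr => s _.
  rewrite ffun_cons0.
  have -> : ord_max = lift ord0 ord_max :> 'I_m.+2 by apply: val_inj.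
  rewrite ffun_consS /path_weight big_ord_recl.
  have -> : ffun_cons a' s (widen_ord (leqnSn m.+1) ord0) = a'.
    by rewrite (_ : widen_ord _ _ = ord0) ?ffun_cons0 //; apply: val_inj.
  rewrite ffun_consS tnth0 (eq_bigr (fun t =>
    step (tnth G t) (s (widen_ord (leqnSn m) t)) (s (lift ord0 t)))).
    by rewrite /path_weight; move: (step _ _ _) (\prod_(t < m) _) => x y; ring.
  move=> t _; rewrite tnthS ffun_consS.
  have -> : widen_ord (leqnSn m.+1) (lift ord0 t) = lift ord0 (widen_ord (leqnSn m) t).
    exact: val_inj.
  by rewrite ffun_consS.
rewrite (sum_pred1 a (fun a' => \sum_(s : {ffun 'I_m.+1 -> state})
   step g a' (s ord0) * (((s ord_max).1 == Q)%:R * (-1) ^+ (s ord_max).2 * path_weight G s))).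
under [RHS]eq_bigr do rewrite mulr_sumr.
rewrite exchange_big /=; apply: eq_bigr => s _.
(* The second state [s ord0] becomes a summation variable [b]. *)
rewrite -[LHS](sum_pred1 (s ord0) (fun b =>
  step g a b * (((s ord_max).1 == Q)%:R * (-1) ^+ (s ord_max).2 * path_weight G s))).
by apply: eq_bigr => b _; rewrite [b == _]eq_sym; move: (step _ _ _) (path_weight _ _) => x y; ring.
Qed.

(** Of the two values of the next sign bit only [r (+) gate_sign] is admissible, so the sign leaves
    the state and enters [gate_weight]. *)
Lemma sum_step g P r (F : state -> R) (H : pauli n -> R) :
    (forall S q, F (S, q) = (-1) ^+ q * H S) ->
  \sum_b step g (P, r) b * F b = (-1) ^+ r * \sum_S gate_weight g P S * H S.
Proof.
move=> FH; transitivity (\sum_S \sum_q step g (P, r) (S, q) * F (S, q)).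
  by rewrite pair_bigA; apply: eq_bigr => -[].
rewrite mulr_sumr.
apply: eq_bigr => S _; rewrite /step /gate_weight /= big_bool /= !FH.
by case: (gate_support _ _ _); case: r; case: (gate_sign _ _ _);
  rewrite /= ?expr0 ?expr1; ring.
Qed.

Lemma circuit_mx_cons g (G : seq (gate R n)) :
  circuit_mx (g :: G) = circuit_mx G *m gate_mx g.
Proof.
rewrite /circuit_mx /= mulmx1 -[in LHS](mul1mx (gate_mx g)).
(* The accumulator of the fold is generalised. *)
elim: G 1%:M => [//|h G IH] A /=.
by rewrite mulmxA IH.
Qed.

Lemma path_sumE m (G : m.-tuple (gate R n)) P r Q :
  (path_sum G (P, r) Q)%:C = (-1) ^+ r * coef (circuit_mx G) P Q.
Proof.
(* [coef] is complex while [sum_step] works in [R], so the induction carries a real function [H],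
   for all initial states at once. *)
suff [H HC Hsum] : exists2 H : pauli n -> R, forall S, (H S)%:C = coef (circuit_mx G) S Q &
    forall S q, path_sum G (S, q) Q = (-1) ^+ q * H S.
  by rewrite Hsum rmorphM /= rmorphXn rmorphN1 HC.
elim: m G {P r} => [|m IH] G.
  exists (fun S => (S == Q)%:R) => [S|S q]; first by rewrite tuple0 coef_id rmorph_nat.
  by rewrite path_sum_nil mulrC.
case/tupleP: G => g G; have [H HC Hsum] := IH G.
exists (fun P => \sum_S gate_weight g P S * H S) => [P|P r].
  rewrite circuit_mx_cons coef_mul rmorph_sum; apply: eq_bigr => S _.
  by rewrite rmorphM /= HC coef_gate.
by rewrite path_sum_cons; exact: sum_step.
Qed.

End Counting.

(** * Satisfying assignments as paths *)

Section Encoding.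
Variables (R : realType) (n m : nat) (G : m.-tuple (gate R n)).
Local Notation state := (pauli n * bool)%type.
Implicit Types (s : {ffun 'I_m.+1 -> state}) (alpha : {ffun var G -> bool}).

(** Auxiliary variables receive the values that the constraints force, so a path determines a whole
    assignment. *)
Definition assignment s : {ffun var G -> bool} := [ffun v =>
  match v with
  | Xvar t j => ((s t).1 j).1
  | Zvar t j => ((s t).1 j).2
  | Rvar t => (s t).2
  | Uvar t c => gate_aux (s (widen_ord (leqnSn m) t)).1 (s (lift ord0 t)).1 c
  end].

Definition states alpha : {ffun 'I_m.+1 -> state} := [ffun t =>
  (pauli_of (fun j => alpha (Xvar G t j)) (fun j => alpha (Zvar G t j)), alpha (Rvar G t))].

Lemma assignmentK : cancel assignment states.
Proof.
move=> s; apply/ffunP => t; rewrite [LHS]ffunE [RHS]surjective_pairing [X in (_, X)]ffunE.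
by congr pair; apply/ffunP => j; rewrite !ffunE -surjective_pairing.
Qed.

Lemma gate_formulaE t alpha : gate_formula t alpha =
  let a := states alpha (widen_ord (leqnSn m) t) in let b := states alpha (lift ord0 t) in
  [&& gate_support (tnth G t) a.1 b.1, b.2 == a.2 (+) gate_sign (tnth G t) a.1 b.1 &
      [forall c : aux (tnth G t), alpha (Uvar c) == gate_aux a.1 b.1 c]].
Proof. by rewrite /gate_formula gate_constraintE !ffunE. Qed.

Lemma statesK alpha : [forall t, gate_formula t alpha] -> assignment (states alpha) = alpha.
Proof.
move=> /forallP F; apply/ffunP => -[t j|t j|t|t c]; rewrite ffunE.
- by rewrite ffunE pauli_of_fst.
- by rewrite ffunE pauli_of_snd.
- by rewrite ffunE.
have := F t; rewrite gate_formulaE => /and3P[_ _ /forallP/(_ c)/eqP ->].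
by [].
Qed.

Lemma prod_var (F : var G -> R) : \prod_v F v =
  (\prod_p F (Xvar G p.1 p.2)) * (\prod_p F (Zvar G p.1 p.2)) * (\prod_t F (Rvar G t)) *
  \prod_t \prod_(c : aux (tnth G t)) F (Uvar c).
Proof.
rewrite (reindex (@var_decode R n m G)) /=; last first.
  exists (@var_code R n m G) => [c _|v _]; last exact: var_codeK.
  by case: c => [[[[? ?]|[? ?]]|?]|[? ?]].
rewrite !big_sumType /=; congr (_ * _ * _ * _).
- by apply: eq_bigr => -[].
- by apply: eq_bigr => -[].
- by rewrite sig_big_dep /=; apply: eq_bigr => -[].
Qed.

(** Only the last [r] and the auxiliary variables can have a weight other than 1. *)
Lemma weight_assignment s : \prod_v weight G v (assignment s v) =
  (-1) ^+ (s ord_max).2 *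
  \prod_t \prod_(c : aux (tnth G t))
    aux_weight c (gate_aux (s (widen_ord (leqnSn m) t)).1 (s (lift ord0 t)).1 c).
Proof.
rewrite prod_var [X in X * _ * _ * _]big1 // [X in _ * X * _ * _]big1 // !mul1r; congr (_ * _).
  rewrite (bigD1 ord_max) //= ffunE eqxx big1 ?mulr1 => [|t /negPf ->] //.
  by case: (s ord_max).2.
by apply: eq_bigr => t _; apply: eq_bigr => c _; rewrite ffunE.
Qed.

Lemma fixed_state (P : pauli n) s t : [forall j, (assignment s (Xvar G t j) == (P j).1) &&
  (assignment s (Zvar G t j) == (P j).2)] = ((s t).1 == P).
Proof.
apply/forallP/eqP => [h|<- j]; last by rewrite !ffunE !eqxx.
apply/ffunP => j; have := h j; rewrite !ffunE -xpair_eqE.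
by rewrite -!surjective_pairing => /eqP.
Qed.

(* The values of the auxiliary variables are forced by the constraints, so the
   satisfying assignments are in bijection with the admissible state paths. *)
Lemma MC_path_sum (P Q : pauli n) :
  MC (weight G) (fand (encoding G P) (final_formula G Q)) = path_sum G (P, false) Q.
Proof.
rewrite /MC /path_sum; under eq_bigr do rewrite mulr_natl mulrb.
rewrite -big_mkcond (reindex_onto assignment states) /=; last first.
  by move=> alpha /andP[/andP[_ /statesK]].
under eq_bigl do rewrite assignmentK eqxx andbT.
rewrite big_mkcond; apply: eq_bigr => s _.
rewrite /fand /encoding /fand /init_formula /final_formula !fixed_state ffunE weight_assignment.
have -> : path_weight G s = [forall t, gate_formula t (assignment s)]%:R *
  \prod_t \prod_(c : aux (tnth G t))
    aux_weight c (gate_aux (s (widen_ord (leqnSn m) t)).1 (s (lift ord0 t)).1 c).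
  rewrite /path_weight big_split /= prodr_bool; congr ((nat_of_bool _)%:R * _).
  apply: eq_forallb => t; rewrite gate_formulaE assignmentK /=; congr (_ && _).
  (* The auxiliary clauses hold by construction of [assignment]. *)
  rewrite [in RHS](_ : [forall c, _] = true) ?andbT //.
  by apply/forallP => c; rewrite ffunE.
have -> : (s ord0 == (P, false)) = ((s ord0).1 == P) && ~~ (s ord0).2.
  by case: (s ord0) => S r; rewrite xpair_eqE eqbF_neg.
case: (_ == P); case: (s ord0).2; case: [forall t, _]; case: (_ == Q);
  by rewrite /= ?(mul0r, mulr0, mul1r).
Qed.

Lemma MC_coef (P Q : pauli n) :
  (MC (weight G) (fand (encoding G P) (final_formula G Q)))%:C = coef (circuit_mx G) P Q.
Proof. by rewrite MC_path_sum path_sumE expr0 mul1r. Qed.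

End Encoding.

(** * Unitaries that fix the Pauli generators are scalar *)

Section Identity.
Variables (R : realType) (n : nat).
Local Notation C := R[i].
Implicit Types (A : 'M[C]_(2 ^ n)) (P Q : pauli n).

Lemma circuit_unitary (G : seq (gate R n)) : circuit_mx G *m dagger (circuit_mx G) = 1%:M.
Proof.
elim: G => [|g G IH]; first by rewrite /circuit_mx /= dagger1 mulmx1.
by rewrite circuit_mx_cons daggerM mulmxA -(mulmxA _ _ (dagger (gate_mx g))) gate_unitary mulmx1.
Qed.

(** Basis vectors are states, their images are the columns of [A], and [c] is the same for all of
    them. *)
Lemma equiv_scalar N (A : 'M[C]_N) : equiv_mx A 1%:M -> exists c, A = c%:M.
Proof.
move=> [c Ac]; exists c; apply/matrixP => i j.
have := Ac (delta_mx j 0); rewrite /is_state mul1mx -colE.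
have -> : dagger (delta_mx j 0 : 'cV[C]_N) *m delta_mx j 0 = 1%:M.
  apply/matrixP => a b; rewrite !ord1 !mxE (bigD1 j) //= !mxE !eqxx big1 => [|k /negPf kj].
    by rewrite rmorph1 mulr1 addr0.
  by rewrite !mxE kj mulr0.
move=> /(_ erefl)/matrixP/(_ i 0); rewrite !mxE => ->.
by rewrite andbT; case: eqP => _; rewrite ?mulr1 ?mulr0.
Qed.

(** The scalar moves past [P] and meets its conjugate, which cancels it. *)
Lemma scalar_coef c P : c%:M *m dagger c%:M = 1%:M :> 'M[C]_(2 ^ n) ->
  coef c%:M P P = 1.
Proof.
move=> cc; rewrite /coef -scalar_mxC -mulmxA cc mulmx1.
by rewrite /pcoef pauli_sqr mxtrace1 mulVf // pow2_neq0.
Qed.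

(** Equality case of Cauchy-Schwarz for the trace inner product: [B] and [P] have squared norm 2^n,
    and so is their inner product. *)
Lemma coef1_conj A P : dagger A *m A = 1%:M -> coef A P P = 1 ->
  A *m pauli_mx R P = pauli_mx R P *m A.
Proof.
move=> A1 cP.
have trP : \tr (pauli_mx R P *m (A *m pauli_mx R P *m dagger A)) = (2 ^ n)%:R.
  by rewrite -[LHS](mulVKf (pow2_neq0 R n)) -[_^-1 * _]/(coef A P P) cP mulr1.
have AA := mulmx1C A1.
set B := A *m pauli_mx R P *m dagger A in trP.
have BB : dagger B *m B = 1%:M.
  rewrite /B !daggerM daggerK pauli_dagger !mulmxA -(mulmxA _ (dagger A) A) A1 mulmx1.
  by rewrite -(mulmxA _ (pauli_mx R P) (pauli_mx R P)) pauli_sqr mulmx1.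
have Bd : dagger B = B by rewrite /B !daggerM daggerK pauli_dagger mulmxA.
have BP : B - pauli_mx R P = 0.
  apply: mxtrace_dagger_eq0.
  rewrite daggerB pauli_dagger mulmxBr !mulmxBl !raddfB /= BB pauli_sqr Bd (mxtrace_mulC B) trP.
  by rewrite mxtrace1 !subrr addr0.
(* Multiplying [B = P] by [A] on the right cancels [dagger A]. *)
by move/subr0_eq: BP => BP; rewrite -[in RHS]BP /B -[RHS]mulmxA A1 mulmx1.
Qed.

Lemma anticommute_coef A P Q : A *m pauli_mx R P = pauli_mx R P *m A ->
    pauli_mx R P *m pauli_mx R Q = - (pauli_mx R Q *m pauli_mx R P) ->
  pcoef A Q = 0.
Proof.
move=> AP PQ.
have : \tr (pauli_mx R Q *m A) = - \tr (pauli_mx R Q *m A).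
  have e1 : pauli_mx R Q *m A = pauli_mx R Q *m pauli_mx R P *m A *m pauli_mx R P.
    by rewrite -!mulmxA AP !mulmxA -(mulmxA (pauli_mx R Q)) pauli_sqr mulmx1.
  rewrite {1}e1 mxtrace_mulC !mulmxA PQ !mulNmx raddfN /=.
  by rewrite -(mulmxA _ (pauli_mx R P) (pauli_mx R P)) pauli_sqr mulmx1.
move/eqP; rewrite -addr_eq0 -mulr2n mulrn_eq0 /= /pcoef => /eqP ->.
exact: mulr0.
Qed.

(** On the only qubit where [S] can act, an odd symplectic product makes the two factors
    anticommute; all other factors commute. *)
Lemma sigma_anticommute j (S Q : pauli n) : (forall q, q != j -> S q = (false, false)) ->
    ((S j).1 && (Q j).2) (+) ((S j).2 && (Q j).1) ->
  pauli_mx R S *m pauli_mx R Q = - (pauli_mx R Q *m pauli_mx R S).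
Proof.
move=> S0 SQ; rewrite !tens_mul -scaleN1r.
have -> : -1 = \prod_q (if q == j then -1 else 1) :> C.
  by rewrite (bigD1 j) //= eqxx big1 ?mulr1 // => q /negPf ->.
rewrite -tens_scale; apply: eq_tens => q; case: eqP => [->|/eqP/S0 ->].
  by move: SQ; case: (S j) (Q j) => [[] []] [[] []] // _; rewrite !sigmaE /= !mx2_mul mx2_scale;
    congr mx2; ring.
by rewrite /= mul1mx mulmx1 scale1r.
Qed.

Lemma commute_scalar A :
    (forall j, A *m pauli_mx R (pauliX j) = pauli_mx R (pauliX j) *m A) ->
    (forall j, A *m pauli_mx R (pauliZ j) = pauli_mx R (pauliZ j) *m A) ->
  exists c, A = c%:M.
Proof.
move=> AX AZ; pose I : pauli n := [ffun=> (false, false)].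
exists (pcoef A I); rewrite [LHS]pauli_expand (bigD1 I) //= big1 => [|Q QI].
  rewrite addr0 -scalemx1 -tens1; congr (_ *: _).
  by apply: eq_tens => q; rewrite ffunE.
have [j Qj] : exists j, Q j != (false, false).
  apply/existsP; apply: contraNT QI => /existsPn Q0.
  by apply/eqP/ffunP => q; rewrite ffunE; apply/eqP; rewrite -[_ == _]negbK Q0.
(* A factor with an X component anticommutes with Z; the only other one different from the identity
   is Z, which anticommutes with X. *)
rewrite (_ : pcoef A Q = 0) ?scale0r //; case EQ: (Q j) Qj => [[] z] // Qj.
- apply: (anticommute_coef (AZ j)); apply: (@sigma_anticommute j).
    by move=> q /negPf qj; rewrite ffunE qj.
  by rewrite ffunE EQ eqxx.
- apply: (anticommute_coef (AX j)); apply: (@sigma_anticommute j).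
    by move=> q /negPf qj; rewrite ffunE qj.
  by rewrite ffunE EQ eqxx; case: z Qj {EQ}.
Qed.

End Identity.

Theorem corollary1 (R : realType) (n m : nat) (n_gt0 : (0 < n)%N)
    (m_gt0 : (0 < m)%N) (G : m.-tuple (gate R n)) :
  equiv_mx (circuit_mx G) 1%:M <->
  forall (j : 'I_n) (P : pauli n), P = pauliX j \/ P = pauliZ j ->
    MC (weight G) (fand (encoding G P) (final_formula G P)) = 1.
Proof.
have AA := circuit_unitary G; split=> [/equiv_scalar[c Ac] j P _|MC1].
  (* Unitarity of the circuit supplies the hypothesis of [scalar_coef] on [c]. *)
  by apply: (@complexI R); rewrite MC_coef Ac scalar_coef // -Ac.
have cA P j : P = pauliX j \/ P = pauliZ j ->
    circuit_mx G *m pauli_mx R P = pauli_mx R P *m circuit_mx G.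
  by move=> Pj; apply: coef1_conj; [exact: mulmx1C|rewrite -MC_coef (MC1 j)].
have [c Ac] := commute_scalar (fun j => cA _ j (or_introl erefl))
  (fun j => cA _ j (or_intror erefl)).
by exists c => psi _; rewrite Ac mul1mx mul_scalar_mx.
Qed.
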